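(* Let $p_0>0.71$, $0<\eta<1/2$, $0<\epsilon<1/2$, and let $\zeta>0$ be small. Choose $\delta=\Theta(\sqrt{1-p_0})$ with $0<\delta\le 4$. Let $$J=\lceil\log_2(1/\epsilon)\rceil+1,\qquad \tau_j=2^{\,j-1-\lceil\log_2(1/\epsilon)\rceil}\,\frac{\delta}{N\epsilon}\quad(1\le j\le J),$$ $$NN_s=\Theta\left(\delta^{-(2+\zeta)}\mathrm{polylog}\left(\log(\zeta^{-1})\log(\epsilon^{-1})\eta^{-1}\right)\right),\qquad \min\{N,N_s\}=\Omega\left(\mathrm{polylog}\left(\log(\epsilon^{-1})\eta^{-1}\right)\right).$$ Let $\theta^*$ be the output of the multi-level QCELS algorithm (see context) with these parameters. Then $$\mathbb{P}\left(|\theta^*-\lambda_0|<\epsilon\right)\ge 1-\eta .$$ In particular, $$T_{\max}=N\tau_J=\frac{\delta}{\epsilon},\qquad T_{\mathrm{total}}=\sum_{j=1}^J \frac{N(N-1)N_s\tau_j}{2}=\Theta\left(\frac{\mathrm{polylog}\left(\log(\zeta^{-1})\log(\epsilon^{-1})\eta^{-1}\right)}{\delta^{1+\zeta}\,\epsilon}\right).$$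
   Context: Setting. $H$ is a Hermitian operator on a finite-dimensional complex Hilbert space with an orthonormal eigenbasis $|\psi_m\rangle$, $0\le m\le M-1$, and eigenvalues $\lambda_m\in\mathbb{R}$; $\lambda_0$ (not necessarily the smallest) is the target eigenvalue and $\lambda_0\in[-\pi,\pi)$. $|\psi\rangle$ is a unit vector and $p_m=|\langle\psi_m|\psi\rangle|^2$. Data with time step $\tau>0$: for integers $N,N_s\ge1$, let $X_{k,n},Y_{k,n}$ ($1\le k\le N_s$, $0\le n\le N-1$) be independent $\{\pm1\}$-valued random variables with $\mathbb{E}X_{k,n}=\mathrm{Re}\langle\psi|e^{-in\tau H}|\psi\rangle$, $\mathbb{E}Y_{k,n}=\mathrm{Im}\langle\psi|e^{-in\tau H}|\psi\rangle$ (Hadamard-test outcomes), and $Z_n=\frac1{N_s}\sum_{k}(X_{k,n}+iY_{k,n})$. Multi-level QCELS algorithm with parameters $N,N_s,J,\{\tau_j\}$: start with $\lambda_{\min}=-\pi$, $\lambda_{\max}=\pi$. For $j=1,\dots,J$: generate fresh independent data $(Z_n)_{n=0}^{N-1}$ with time step $\tau_j$; let $(r_j^*,\theta_j^* )$ minimize $\frac1N\sum_{n=0}^{N-1}|Z_n-re^{-i\theta n\tau_j}|^2$ over $r\in\mathbb{C}$, $\theta\in[\lambda_{\min},\lambda_{\max}]$; then set $\lambda_{\min}=\theta_j^*-\frac{\pi}{2\tau_j}$, $\lambda_{\max}=\theta_j^*+\frac{\pi}{2\tau_j}$. The output is $\theta^*=\theta_J^*$. $T_{\max}$ and $T_{\mathrm{total}}$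 are the maximal and total evolution times, given by the formulas in the claim. Asymptotic convention: the assertion is that there are suitable constants (those implicit in $\Omega$, $\Theta$, in ''small'', and the exponents in $\mathrm{polylog}$), depending on nothing except possibly $\zeta$, for which it holds for all remaining parameters. A hypothesis $A=\Omega(B)$ means $A\ge CB$ with $C$ large enough; $A=\Theta(B)$ means $cB\le A\le c'B$, where for the choices of $\delta$ and $NN_s$ the lower constant $c$ is suitably large; $\mathrm{polylog}(x_1x_2\cdots)$ denotes a fixed power of $2+\sum_i|\log x_i|$. *)

(* Defs.v *)
(* [R[i]] is the type of complex numbers over R; Re and Im are qualified as
   complex.Re and complex.Im because ssrnum has its own. *)
From HB Require Import structures.
From mathcomp Require Import all_boot all_order all_algebra.
From mathcomp Require Import all_classical all_reals all_analysis.
From mathcomp Require Import complex.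

Set Implicit Arguments.
Unset Strict Implicit.
Unset Printing Implicit Defensive.

Import Order.TTheory GRing.Theory Num.Theory.
Import numFieldNormedType.Exports.
Import ComplexField.Normc.

Local Open Scope classical_set_scope.
Local Open Scope ring_scope.
Local Open Scope complex_scope.
Local Open Scope sesquilinear_scope.

(* The Hilbert space is C^d with kets as column vectors; antilinear on the left. *)
Definition braket (R : realType) (d : nat) (u v : 'cV[R[i]]_d) : R[i] :=
  (u ^t* *m v) 0 0.

Definition cis (R : realType) (t : R) : R[i] := cos t +i* sin t.

(* Matrix exponential as the entrywise sum of the exponential series. *)
Definition mexp_partial (R : realType) (d : nat) (A : 'M[R[i]]_d.+1) (n : nat)
    : 'M[R[i]]_d.+1 :=
  \sum_(k < n) (k`!%:R)^-1 *: A ^+ k.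

Definition mexp (R : realType) (d : nat) (A : 'M[R[i]]_d.+1) : 'M[R[i]]_d.+1 :=
  \matrix_(i, j)
    (limn (fun n => complex.Re (mexp_partial A n i j) : R)
     +i* limn (fun n => complex.Im (mexp_partial A n i j) : R)).

(* <phi| exp(-i t H) |phi> *)
Definition autocorr (R : realType) (d : nat) (H : 'M[R[i]]_d.+1)
    (phi : 'cV[R[i]]_d.+1) (t : R) : R[i] :=
  braket phi (mexp ((0 +i* (- t)) *: H) *m phi).

Definition mutually_independent (dsp : measure_display)
    (T : measurableType dsp) (R : realType) (P : probability T R)
    (I : eqType) (D : pred I) (X : I -> {RV P >-> R}) : Prop :=
  forall (s : seq I) (B : I -> set R),
    uniq s -> all D s -> (forall i, measurable (B i)) ->
    P (\big[setI/setT]_(i <- s) (X i @^-1` B i)) =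
    (\prod_(i <- s) P (X i @^-1` B i))%E.

(* Levels are numbered from 1 to J.  All levels together form one independent
   family: the time steps are deterministic, so the law of the data at a level
   does not depend on the outcome of the previous levels. *)
Definition hadamard_data (dsp : measure_display)
    (T : measurableType dsp) (R : realType) (P : probability T R)
    (d : nat) (H : 'M[R[i]]_d.+1) (phi : 'cV[R[i]]_d.+1)
    (J N Ns : nat) (tau : nat -> R)
    (X Y : nat -> 'I_Ns -> 'I_N -> {RV P >-> R}) : Prop :=
  [/\ forall j k n w, (1 <= j <= J)%N ->
        (X j k n w = 1 \/ X j k n w = -1) /\ (Y j k n w = 1 \/ Y j k n w = -1),
      forall j k n, (1 <= j <= J)%N ->
        ('E_P[X j k n] = (complex.Re (autocorr H phi (n%:R * tau j)))%:E)%E /\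
        ('E_P[Y j k n] = (complex.Im (autocorr H phi (n%:R * tau j)))%:E)%E
    & mutually_independent
        (fun a : nat * 'I_Ns * 'I_N * bool => (1 <= a.1.1.1 <= J)%N)
        (fun a => if a.2 then X a.1.1.1 a.1.1.2 a.1.2
                  else Y a.1.1.1 a.1.1.2 a.1.2)].

Definition sample_mean (R : realType) (N Ns : nat) (x y : 'I_Ns -> 'I_N -> R)
    (n : 'I_N) : R[i] :=
  (Ns%:R)^-1 * \sum_(k < Ns) (x k n +i* y k n).

Definition qcels_loss (R : realType) (N : nat) (tau : R) (Z : 'I_N -> R[i])
    (r : R[i]) (theta : R) : R :=
  (N%:R)^-1 *
  \sum_(n < N) normc (Z n - r * cis (- (theta * n%:R * tau))) ^+ 2.

(* Bounds of the search interval at level j, given the previous estimates. *)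
Definition lambda_min (R : realType) (tau theta : nat -> R) (j : nat) : R :=
  if j == 1%N then - pi else theta j.-1 - pi / (2 * tau j.-1).

Definition lambda_max (R : realType) (tau theta : nat -> R) (j : nat) : R :=
  if j == 1%N then pi else theta j.-1 + pi / (2 * tau j.-1).

(* (r, theta) is a possible execution on the data Z, with output [theta J];
   any rule may be used to select among several minimizers. *)
Definition qcels_run (R : realType) (J N : nat) (tau : nat -> R)
    (Z : nat -> 'I_N -> R[i]) (r : nat -> R[i]) (theta : nat -> R) : Prop :=
  forall j, (1 <= j <= J)%N ->
    lambda_min tau theta j <= theta j <= lambda_max tau theta j /\
    forall (r' : R[i]) (theta' : R),
      lambda_min tau theta j <= theta' <= lambda_max tau theta j ->
      qcels_loss (tau j) (Z j) (r j) (theta j) <=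
      qcels_loss (tau j) (Z j) r' theta'.

(* [absz] only serves to land in nat: the ceiling is positive for eps < 1. *)
Definition ceil_log2V (R : realType) (eps : R) : nat :=
  `|Num.ceil (ln eps^-1 / ln 2)|%N.

Definition qcels_J (R : realType) (eps : R) : nat := (ceil_log2V eps).+1.

Definition qcels_tau (R : realType) (delta eps : R) (N j : nat) : R :=
  2 ^ (j%:Z - 1 - (ceil_log2V eps)%:Z) * (delta / (N%:R * eps)).

Definition T_max (R : realType) (N J : nat) (tau : nat -> R) : R :=
  N%:R * tau J.

Definition T_total (R : realType) (N Ns J : nat) (tau : nat -> R) : R :=
  \sum_(1 <= j < J.+1) N%:R * (N%:R - 1) * Ns%:R * tau j / 2.

Definition is_Theta (R : realType) (c c' A B : R) : Prop :=
  c * B <= A <= c' * B.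

(* polylog(x1 x2 ...), with exponent k, for xs = [:: x1; x2; ...] *)
Definition polylog (R : realType) (k : nat) (xs : seq R) : R :=
  (2 + \sum_(x <- xs) `|ln x|) ^+ k.

Definition delta_choice (R : realType) (c c' p0 delta : R) : Prop :=
  0 < delta <= 4 /\ is_Theta c c' delta (Num.sqrt (1 - p0)).

(* [c], [c'], [k] are the constants and the exponent in the condition on N Ns;
   [c0], [l] those in the condition on min(N, Ns). *)
Definition size_choice (R : realType) (c c' : R) (k : nat) (c0 : R) (l : nat)
    (zeta eps eta delta : R) (N Ns : nat) : Prop :=
  [/\ (0 < N)%N, (0 < Ns)%N,
      is_Theta c c' (N%:R * Ns%:R)
        (delta `^ (- (2 + zeta)) *
         polylog k [:: ln zeta^-1; ln eps^-1; eta^-1])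
    & c0 * polylog l [:: ln eps^-1; eta^-1] <= (minn N Ns)%:R].

(* Main.v *)
(* Write x = N tau (theta - lambda_0).  Minimizing over r turns the loss into the
   maximization of the modulus of the Fourier sum
     p_0 s(x) + (contribution of the other eigenvalues) + noise(x)
   where s is a Dirichlet kernel.  The other eigenvalues contribute at most 1 - p_0
   in modulus, and at least - 0.26 (1 - p_0) to the real part at x = 0; this is
   where p_0 > 0.71 enters.

   At every level the mean of |noise| is small, whence |x| < 9/2: the target stays in
   the next search interval.  At the last level |noise(x) - noise(0)| is small
   compared to delta |x| on a grid of step delta^2, and 1 - s(x) is of order x^2;
   this excludes delta <= |x| < 9/2, so |theta - lambda_0| < eps.  Both noise bounds
   are union bounds over finitely many linear forms in the +-1 outcomes, each
   controlled by Hoeffding's inequality. *)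
Require Import Defs.
From HB Require Import structures.
From mathcomp Require Import all_boot all_order all_algebra.
From mathcomp Require Import all_classical all_reals all_analysis.
From mathcomp Require Import complex ring lra.

Set Implicit Arguments.
Unset Strict Implicit.
Unset Printing Implicit Defensive.

Import Order.TTheory GRing.Theory Num.Theory.
Import numFieldNormedType.Exports.
Import ComplexField.Normc.

Local Open Scope classical_set_scope.
Local Open Scope ring_scope.
Local Open Scope complex_scope.

(** * Trigonometric estimates *)

(** The algorithm is adaptive but its time steps are not: once the noise bounds hold at every level,
    the whole run succeeds deterministically. No conditioning on earlier estimates is needed, and
    the failure probabilities simply add up. Each hypothesis on the sample sizes pays for one union
    bound. The coarse one runs over 4 ^ N sign patterns, each failing with probability exp (- c N
    Ns): Ns above a large constant beats 4 ^ N, and the remaining exp (- N) beats 1 / eta and the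
    number of levels, which is O(log (1 / eps)). This controls the noise only up to a constant,
    whereas at the last level the kernel may drop by as little as order delta ^ 2 next to the
    target. Hence increments of the noise are tested there: the exponent is then of order delta ^ 2
    N Ns, at least delta ^ (- zeta) times logarithms. Since ln (1 / delta) <= delta ^ (- zeta) /
    zeta, it also covers the number of grid points, at the price of a constant [cN] that grows like
    1 / zeta. *)

Lemma le_from0 (R : realType) (f df : R -> R) (x : R) :
  (forall y : R, is_derive y 1 f (df y)) -> (forall y, 0 <= y -> 0 <= df y) ->
  0 <= x -> f 0 <= f x.
Proof.
move=> hf df0 x0.
have [->|xN0] := eqVneq x 0; first by [].
have x1 : 0 < x by rewrite lt_neqAle eq_sym xN0.
have [|c + e] := @MVT R f df 0 x x1 (fun y _ => hf y).
  apply: derivable_within_continuous => y _.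
  by have [] := hf y.
rewrite in_itv/= => /andP[c0 _].
by rewrite -subr_ge0 e mulr_ge0 ?df0 ?(ltW c0) ?subr_ge0.
Qed.

(** First link of a chain: [sin_le], [cos_ge], [sin_ge] and [cos_le] each provide the sign of the
    derivative that [le_from0] needs for the next Taylor bound. *)
Lemma sin_le (R : realType) (v : R) : 0 <= v -> sin v <= v.
Proof.
move=> v0; rewrite -subr_ge0.
have := @le_from0 R (fun v => v - sin v) (fun v => 1 - cos v) v.
rewrite sin0 subr0; apply => //.
Qed.

Lemma cos_ge (R : realType) (v : R) : 1 - v ^+ 2 / 2 <= cos v.
Proof.
wlog v0 : v / 0 <= v.
  move=> h; have [/h//|/ltW v0] := leP 0 v.
  by rewrite -cosN -sqrrN h ?oppr_ge0.
rewrite -subr_ge0.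
have := @le_from0 R (fun v => cos v - (1 - v ^+ 2 / 2)) (fun v => v - sin v) v.
rewrite cos0 expr0n mul0r subr0 subrr; apply => //.
  move=> y; apply: is_derive_eq.
  by rewrite /GRing.scale/=; field.
by move=> y y0; rewrite subr_ge0 sin_le.
Qed.

Lemma sin_ge (R : realType) (v : R) : 0 <= v -> v - v ^+ 3 / 6 <= sin v.
Proof.
move=> v0; rewrite -subr_ge0.
have := @le_from0 R (fun v => sin v - (v - v ^+ 3 / 6))
  (fun v => cos v - (1 - v ^+ 2 / 2)) v.
rewrite sin0 expr0n mul0r !subr0; apply => //.
  move=> y; apply: is_derive_eq.
  by rewrite /GRing.scale/=; field.
by move=> y _; rewrite subr_ge0 cos_ge.
Qed.

Lemma cos_le (R : realType) (v : R) : cos v <= 1 - v ^+ 2 / 2 + v ^+ 4 / 24.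
Proof.
wlog v0 : v / 0 <= v.
  move=> h; have [/h//|/ltW v0] := leP 0 v.
  rewrite -cosN -(sqrrN v).
  rewrite (_ : v ^+ 4 = (- v) ^+ 4); last by ring.
  by rewrite h ?oppr_ge0.
rewrite -subr_ge0.
have := @le_from0 R (fun v => 1 - v ^+ 2 / 2 + v ^+ 4 / 24 - cos v)
  (fun v => sin v - (v - v ^+ 3 / 6)) v.
rewrite cos0 !expr0n/= !mul0r subr0 addr0 subrr; apply => //.
  move=> y; apply: is_derive_eq.
  by rewrite /GRing.scale/=; field.
by move=> y y0; rewrite subr_ge0 sin_ge.
Qed.

Lemma sin_ge_third (R : realType) (v : R) : 0 <= v <= 2 -> v / 3 <= sin v.
Proof.
move=> /andP[v0 v2]; apply: le_trans (sin_ge v0).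
have -> : v - v ^+ 3 / 6 = v / 3 + v * ((2 - v) * (2 + v)) / 6 by field.
by rewrite lerDl divr_ge0// !mulr_ge0// ?subr_ge0// addr_ge0.
Qed.

(** If pi were below 3, cos (pi / 4) would be at least 1 - 9 / 32, twice the square of which exceeds
    1, against cos (pi / 2) = 0. *)
Lemma pi_ge3 (R : realType) : 3 <= pi :> R.
Proof.
rewrite leNgt; apply/negP => pi3.
have := cos_pihalf R; have := pi_ge2 R.
rewrite (_ : pi / 2 = (pi / 4) *+ 2); last by rewrite -mulr_natr; field.
rewrite cos_mulr2n => pi2.
have := cos_ge (pi / 4 : R).
move: pi3 pi2; rewrite -mulr_natr; set p := pi; set c := cos _ => p3 p2 h1 h2.
have : 7 / 10 < c by nra.
nra.
Qed.

(** Telescoping: 2 sin (y / 2) cos (n y) is the difference of sin ((n + 1/2) y) and sin ((n - 1/2)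
    y). *)
Lemma dirichlet_cos (R : realType) (N : nat) (y : R) :
  2 * sin (y / 2) * \sum_(n < N) cos (n%:R * y) =
  sin ((N%:R - 2^-1) * y) + sin (y / 2).
Proof.
elim: N => [|N IH].
  rewrite big_ord0 mulr0 mulr0n sub0r mulNr sinN.
  by rewrite mulrC addNr.
rewrite big_ord_recr/= mulrDr IH -addrA [sin (y / 2) + _]addrC addrA.
congr (_ + _).
rewrite -[N.+1%:R]natr1.
rewrite (_ : (N%:R - 2^-1) * y = N%:R * y - y / 2); last by field.
rewrite (_ : (N%:R + 1 - 2^-1) * y = N%:R * y + y / 2); last by field.
by rewrite sinB sinD; ring.
Qed.

(* Centering the index multiplies a Fourier sum by a phase and makes the kernel
   [dirichlet] real. *)
Definition centered (R : realType) (N : nat) (n : nat) : R :=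
  (n%:R - (N%:R - 1) / 2) / N%:R.

Definition dirichlet (R : realType) (N : nat) (x : R) : R :=
  N%:R^-1 * \sum_(n < N) cos (x * centered R N n).

(** Reversing the index negates [centered], so the sum equals its opposite. *)
Lemma sum_sin_centered (R : realType) (N : nat) (x : R) :
  \sum_(n < N) sin (x * centered R N n) = 0.
Proof.
apply: (@mulrI _ 2); first by rewrite unitfE.
rewrite mulr0 mulr_natl mulr2n {1}(reindex_inj rev_ord_inj) -big_split/=.
apply: big1 => n _; rewrite -[X in _ + X]opprK -sinN -mulrN.
apply/eqP; rewrite subr_eq0; apply/eqP; congr (sin (x * _)).
rewrite /centered.
have N0 : N%:R != 0 :> R by rewrite pnatr_eq0 -lt0n (leq_trans _ (ltn_ord n)).
by rewrite natrB ?ltn_ord// -[n.+1%:R]natr1; field.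
Qed.

(** Telescoping again, with half-step x / (2 N). The identity stays multiplied out because sin (x /
    (2 N)) may vanish. *)
Lemma dirichletE (R : realType) (N : nat) (x : R) : (0 < N)%N ->
  N%:R * sin (x / (2 * N%:R)) * dirichlet N x = sin (x / 2).
Proof.
move=> N0; have N0' : N%:R != 0 :> R by rewrite pnatr_eq0 -lt0n.
rewrite /dirichlet mulrA [N%:R * _]mulrC mulfK//.
have tele (M : nat) : sin (x / (2 * N%:R)) *
    (2 * \sum_(n < M) cos (x * centered R N n)) =
    sin (x * (centered R N M - (2 * N%:R)^-1)) + sin (x / 2).
  elim: M => [|M IH].
    rewrite big_ord0 !mulr0; apply/esym/eqP; rewrite addr_eq0 -sinN.
    by apply/eqP; congr sin; rewrite /centered mulr0n; field.
  rewrite big_ord_recr/= mulrDr mulrDr IH addrAC; congr (_ + _).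
  rewrite (_ : centered R N M.+1 = centered R N M + N%:R^-1); last first.
    by rewrite /centered -[M.+1%:R]natr1; field.
  set a := centered R N M.
  rewrite (_ : x * (a - _) = x * a - x / (2 * N%:R)); last by field.
  rewrite (_ : x * (a + _ - _) = x * a + x / (2 * N%:R)); last by field.
  by rewrite sinB sinD; ring.
apply: (@mulrI _ 2); first by rewrite unitfE.
rewrite mulrCA tele (_ : x * (centered R N N - _) = x / 2); first by ring.
by rewrite /centered; field.
Qed.

Lemma dirichlet_le1 (R : realType) (N : nat) (x : R) : (0 < N)%N ->
  `|dirichlet N x| <= 1.
Proof.
move=> N0; rewrite /dirichlet normrM ger0_norm ?invr_ge0//.
rewrite ler_pdivrMl ?ltr0n// mulr1; apply: le_trans (ler_norm_sum _ _ _) _.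
apply: le_trans (ler_sum _ (fun i _ => cos_max _)) _.
by rewrite sumr_const card_ord.
Qed.

Lemma dirichletN (R : realType) (N : nat) (x : R) :
  dirichlet N (- x) = dirichlet N x.
Proof. by congr (_ * _); apply: eq_bigr => n _; rewrite mulNr cosN. Qed.

Lemma sum_centered_sqr (R : realType) (N : nat) : (0 < N)%N ->
  \sum_(n < N) centered R N n ^+ 2 = (N%:R - N%:R^-1) / 12.
Proof.
move=> N0; have N0' : N%:R != 0 :> R by rewrite pnatr_eq0 -lt0n.
(* The centre becomes a free c: the one in [centered] moves with N, which would block the
   induction. *)
have key (c : R) (M : nat) : \sum_(n < M) (n%:R - c) ^+ 2 =
   M%:R * (M%:R - 1) * (2 * M%:R - 1) / 6 - c * M%:R * (M%:R - 1) + M%:R * c ^+ 2.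
  elim: M => [|M IH]; first by rewrite big_ord0 !mulr0n; ring.
  by rewrite big_ord_recr/= IH -[M.+1%:R]natr1; field.
under eq_bigr do rewrite /centered expr_div_n.
by rewrite -mulr_suml key; field.
Qed.

(** The number 1 / 80 is the integral of u ^ 4 over [-1/2, 1/2], the limit of the mean as N
    grows. *)
Lemma sum_centered_quart (R : realType) (N : nat) : (0 < N)%N ->
  \sum_(n < N) centered R N n ^+ 4 <= N%:R / 80.
Proof.
move=> N0; have N0' : N%:R != 0 :> R by rewrite pnatr_eq0 -lt0n.
have key (c : R) (M : nat) : \sum_(n < M) (n%:R - c) ^+ 4 =
   M%:R * (M%:R - 1) * (2 * M%:R - 1) * (3 * M%:R ^+ 2 - 3 * M%:R - 1) / 30
   - 4 * c * (M%:R * (M%:R - 1) / 2) ^+ 2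
   + 6 * c ^+ 2 * (M%:R * (M%:R - 1) * (2 * M%:R - 1) / 6)
   - 4 * c ^+ 3 * (M%:R * (M%:R - 1) / 2) + M%:R * c ^+ 4.
  elim: M => [|M IH]; first by rewrite big_ord0 !mulr0n; ring.
  by rewrite big_ord_recr/= IH -[M.+1%:R]natr1; field.
under eq_bigr do rewrite /centered expr_div_n.
rewrite -mulr_suml key ler_pdivrMr ?exprn_gt0 ?ltr0n//.
have N1 : 1 <= N%:R :> R by rewrite ler1n.
set M := N%:R in N1 *.
rewrite -subr_ge0.
have -> : M / 80 * M ^+ 4 - (M * (M - 1) * (2 * M - 1) * (3 * M ^+ 2 - 3 * M - 1) / 30 -
  4 * ((M - 1) / 2) * (M * (M - 1) / 2) ^+ 2 +
  6 * ((M - 1) / 2) ^+ 2 * (M * (M - 1) * (2 * M - 1) / 6) -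
  4 * ((M - 1) / 2) ^+ 3 * (M * (M - 1) / 2) + M * ((M - 1) / 2) ^+ 4)
  = M * (10 * M ^+ 2 - 7) / 240 by field.
apply: divr_ge0; last exact: ler0n.
by apply: mulr_ge0; clear -N1; nra.
Qed.

Lemma dirichlet_taylor (R : realType) (N : nat) (x : R) : (0 < N)%N ->
  dirichlet N x <= 1 - x ^+ 2 / 24 * (1 - N%:R ^- 2) + x ^+ 4 / (24 * 80).
Proof.
move=> N0; have N0' : N%:R != 0 :> R by rewrite pnatr_eq0 -lt0n.
rewrite /dirichlet ler_pdivrMl ?ltr0n//.
apply: le_trans (ler_sum _ (fun n _ => cos_le _)) _.
rewrite big_split/= sumrB sumr_const card_ord.
rewrite (eq_bigr (fun n : 'I_N => x ^+ 2 / 2 * centered R N n ^+ 2)); last first.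
  by move=> n _; ring.
rewrite [X in _ + X](eq_bigr (fun n : 'I_N => x ^+ 4 / 24 * centered R N n ^+ 4)).
  2: by move=> n _; ring.
rewrite -!mulr_sumr sum_centered_sqr//.
have := sum_centered_quart R N0; set S := \sum_(i < N) _ => hS.
have : x ^+ 4 / 24 * S <= x ^+ 4 / 24 * (N%:R / 80).
  by rewrite ler_wpM2l// divr_ge0// (_ : x ^+ 4 = (x ^+ 2) ^+ 2) ?sqr_ge0//; ring.
move=> h; rewrite -subr_ge0; move: h; rewrite -subr_ge0.
by congr (0 <= _); field.
Qed.

Lemma dirichlet_ge (R : realType) (N : nat) (x : R) : (0 < N)%N ->
  1 - x ^+ 2 / 24 <= dirichlet N x.
Proof.
move=> N0; have N0' : N%:R != 0 :> R by rewrite pnatr_eq0 -lt0n.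
rewrite /dirichlet ler_pdivlMl ?ltr0n//.
apply: le_trans (ler_sum _ (fun n _ => cos_ge _)).
rewrite sumrB sumr_const card_ord.
rewrite (eq_bigr (fun n : 'I_N => x ^+ 2 / 2 * centered R N n ^+ 2)); last first.
  by move=> n _; ring.
rewrite -!mulr_sumr sum_centered_sqr//.
rewrite -subr_ge0.
have -> : 1 *+ N - x ^+ 2 / 2 * ((N%:R - N%:R^-1) / 12) - N%:R * (1 - x ^+ 2 / 24)
  = x ^+ 2 * N%:R^-1 / 24 :> R by field.
by rewrite divr_ge0// mulr_ge0 ?sqr_ge0// invr_ge0.
Qed.
(** By [dirichletE] it suffices that N sin v >= 20 / 9 for v = x / (2 N). The upper limit on |x|
    keeps v at most 3 pi / 4, away from the zero of sin at pi, where the periodic kernel is again of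
    modulus 1. *)
Lemma dirichlet_far (R : realType) (N : nat) (x : R) : (1000 <= N)%N ->
  9 / 2 <= `|x| <= 3 / 2 * pi * N%:R -> `|dirichlet N x| <= 9 / 20.
Proof.
move=> N1000 /andP[x1 x2].
wlog x0 : x x1 x2 / 0 <= x.
  move=> h; have [/h|/ltW x0] := leP 0 x; first exact.
  by rewrite -dirichletN h ?normrN ?oppr_ge0.
have NR : 1000 <= N%:R :> R by rewrite ler_nat.
have N0 : (0 < N)%N by exact: leq_trans N1000.
move: x1 x2; rewrite ger0_norm// => x1 x2.
set v := x / (2 * N%:R).
have xv : x = v * (2 * N%:R) by rewrite /v; field; lra.
have v0 : 0 <= v by rewrite divr_ge0//; lra.
have v3 : v <= 3 / 4 * pi.
  by rewrite /v ler_pdivrMr; lra.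
have := dirichletE x N0; rewrite -/v.
have sx := sin_max (x / 2).
have pi3 := pi_ge3 R.
have pi4 : pi < 4 :> R by have := pihalf_lt2 R; lra.
suff hs : 20 / 9 <= N%:R * sin v.
  move=> e; move: sx; rewrite -e normrM ger0_norm; last by lra.
  by have := normr_ge0 (dirichlet N x); nra.
(* For small v, N sin v is nearly x / 2 >= 9 / 4, slightly above 20 / 9. For larger v, sin v >= 1 /
   60 and N >= 1000 leave ample room. *)
have [v1|v1] := leP v (1 / 20).
  have := sin_ge v0; have := sqr_ge0 v => v2.
  rewrite (_ : v ^+ 3 = v ^+ 2 * v); last by ring.
  move=> hs; have : v * (999 / 1000) <= sin v by nra.
  by move=> h; nra.
suff : 1 / 60 <= sin v by nra.
have [vp|vp] := leP v (pi / 2).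
  by have := @sin_ge_third R v; lra.
have := @sin_ge_third R (pi - v).
rewrite sinB sinpi cospi mul0r sub0r mulN1r opprK.
by lra.
Qed.

(** cos (n y) is the Chebyshev polynomial of degree n at cos y, whence the two-step recurrence. It
    lets y be replaced by acos (cos y), which lies in [0, pi], without reduction modulo 2 pi. *)
Lemma cos_natmul_eq (R : realType) (y z : R) (n : nat) : cos y = cos z ->
  cos (n%:R * y) = cos (n%:R * z).
Proof.
move=> yz.
suff : cos (n%:R * y) = cos (n%:R * z) /\ cos (n.+1%:R * y) = cos (n.+1%:R * z).
  by case.
elim: n => [|n [IH1 IH2]]; first by rewrite !mul0r !mul1r.
split => //.
have rec (t : R) : cos (n.+2%:R * t) = 2 * cos t * cos (n.+1%:R * t) - cos (n%:R * t).
  rewrite (_ : n.+2%:R * t = n.+1%:R * t + t); last by rewrite -natr1; ring.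
  rewrite (_ : n%:R * t = n.+1%:R * t - t); last by rewrite -natr1; ring.
  by rewrite cosD cosB; ring.
by rewrite !rec yz IH1 IH2.
Qed.

(* As N grows the infimum tends to that of sin z / z, about -0.217. *)
Lemma mean_cos_ge (R : realType) (N : nat) (y : R) : (1000 <= N)%N ->
  - (26 / 100) <= N%:R^-1 * \sum_(n < N) cos (n%:R * y).
Proof.
move=> N1000.
have NR : 1000 <= N%:R :> R by rewrite ler_nat.
have cy : -1 <= cos y <= 1 by rewrite cos_geN1 cos_le1.
wlog yp : y cy / 0 <= y <= pi.
  move=> h; rewrite (eq_bigr (fun n : 'I_N => cos (n%:R * acos (cos y)))).
    by apply: h; rewrite ?acosK ?in_itv/= ?acos_ge0 ?acos_lepi.
  by move=> n _; apply: cos_natmul_eq; rewrite acosK// in_itv.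
case/andP: yp => y0 yp.
have pi3 := pi_ge3 R.
have pi4 : pi < 4 :> R by have := pihalf_lt2 R; lra.
rewrite ler_pdivlMl; last by lra.
have := dirichlet_cos N y; set S := \sum_(n < N) _ => eS.
have [y00|yN0] := eqVneq y 0.
  rewrite /S y00; under eq_bigr do rewrite mulr0 cos0.
  by rewrite sumr_const card_ord; lra.
have y1 : 0 < y by rewrite lt_neqAle eq_sym yN0.
set z := (N%:R - 2^-1) * y in eS.
have z0 : 0 <= z by rewrite mulr_ge0//; lra.
have s0 : y / 6 <= sin (y / 2) by have := @sin_ge_third R (y / 2); lra.
suff h : - (52 / 100 * N%:R) * sin (y / 2) <= sin z by nra.
(* If N y >= 12 or z >= 4, the left-hand side is at most -1; if z <= pi, sin z is nonnegative. For
   pi < z < 4, sin z >= pi - z, and z - pi is at most about 0.26 z because pi >= 3. *)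
have [yN|yN] := leP 12 (N%:R * y).
  by have := sin_geN1 z; clear -s0 yN NR; nra.
have y12 : y <= 12 / 1000 by clear -yN NR y1; nra.
have s1 : y / 2 * (999 / 1000) <= sin (y / 2).
  have y20 : 0 <= y / 2 by lra.
  have := sin_ge y20; rewrite (_ : (y / 2) ^+ 3 = y * (y / 2) ^+ 2 / 2); last by field.
  by clear -y1 y12; nra.
have zy : z <= N%:R * y by rewrite /z ler_wpM2r// gerBl invr_ge0.
have [z4|z4] := leP 4 z.
  by have := sin_geN1 z; clear -z4 zy s1 NR; nra.
have [zpi|zpi] := leP z pi.
  by have := @sin_ge0_pi R z; rewrite z0 zpi => /(_ isT); clear -s1 y1 NR; nra.
have zp0 : 0 <= z - pi by rewrite subr_ge0 ltW.
have := sin_le zp0; rewrite sinB sinpi cospi => hz.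
by clear -hz z4 zpi zy s1 NR pi3; nra.
Qed.

(** * Modulus, real and imaginary parts, and phases *)

Lemma normc_ge0 (R : rcfType) (z : R[i]) : 0 <= normc z.
Proof. by case: z => a b; exact: sqrtr_ge0. Qed.

Lemma normc_sqr (R : rcfType) (z : R[i]) :
  normc z ^+ 2 = complex.Re z ^+ 2 + complex.Im z ^+ 2.
Proof. by case: z => a b /=; rewrite sqr_sqrtr// addr_ge0 ?sqr_ge0. Qed.

Lemma normc_real (R : rcfType) (x : R) : normc x%:C = `|x|.
Proof. by rewrite /= expr0n addr0 sqrtr_sqr. Qed.

Lemma normc_real_ge0 (R : rcfType) (x : R) : 0 <= x -> normc x%:C = x.
Proof. by move=> x0; rewrite normc_real ger0_norm. Qed.

Lemma normRe_le (R : rcfType) (z : R[i]) : `|complex.Re z| <= normc z.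
Proof.
rewrite -(ler_pXn2r (_ : 0 < 2)%N) ?nnegrE ?normc_ge0// normc_sqr.
by rewrite real_normK ?num_real// lerDl sqr_ge0.
Qed.

Lemma normIm_le (R : rcfType) (z : R[i]) : `|complex.Im z| <= normc z.
Proof.
rewrite -(ler_pXn2r (_ : 0 < 2)%N) ?nnegrE ?normc_ge0// normc_sqr.
by rewrite real_normK ?num_real// lerDr sqr_ge0.
Qed.

Lemma normc_le_ReIm (R : rcfType) (z : R[i]) :
  normc z <= `|complex.Re z| + `|complex.Im z|.
Proof.
rewrite -(ler_pXn2r (_ : 0 < 2)%N) ?nnegrE ?normc_ge0 ?addr_ge0// normc_sqr.
rewrite sqrrD !real_normK ?num_real//.
by rewrite -addrA lerD2l lerDr mulrn_wge0 ?mulr_ge0.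
Qed.

Lemma normc_sum (R : rcfType) (I : Type) (s : seq I) (P : pred I) (f : I -> R[i]) :
  normc (\sum_(i <- s | P i) f i) <= \sum_(i <- s | P i) normc (f i).
Proof.
elim/big_ind2 : _ => //; first by rewrite normc0.
by move=> x1 x2 y1 y2 h1 h2; apply: le_trans (le_normcD _ _) (lerD h1 h2).
Qed.

Lemma complex_ReD (R : rcfType) (x y : R[i]) :
  complex.Re (x + y) = complex.Re x + complex.Re y.
Proof. by case: x y => [a b] [c d]. Qed.

Lemma complex_ImD (R : rcfType) (x y : R[i]) :
  complex.Im (x + y) = complex.Im x + complex.Im y.
Proof. by case: x y => [a b] [c d]. Qed.

Lemma complex_Re_sum (R : rcfType) (I : Type) (s : seq I) (P : pred I) (f : I -> R[i]) :
  complex.Re (\sum_(i <- s | P i) f i) = \sum_(i <- s | P i) complex.Re (f i).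
Proof. by elim/big_ind2 : _ => // x1 x2 y1 y2 <- <-; exact: complex_ReD. Qed.

Lemma complex_Im_sum (R : rcfType) (I : Type) (s : seq I) (P : pred I) (f : I -> R[i]) :
  complex.Im (\sum_(i <- s | P i) f i) = \sum_(i <- s | P i) complex.Im (f i).
Proof. by elim/big_ind2 : _ => // x1 x2 y1 y2 <- <-; exact: complex_ImD. Qed.

Lemma complex_ReM (R : rcfType) (x y : R[i]) : complex.Re (x * y) =
  complex.Re x * complex.Re y - complex.Im x * complex.Im y.
Proof. by case: x y => [a b] [c d]. Qed.

Lemma complex_ImM (R : rcfType) (x y : R[i]) : complex.Im (x * y) =
  complex.Re x * complex.Im y + complex.Im x * complex.Re y.
Proof. by case: x y => [a b] [c d]. Qed.

Lemma cisD (R : realType) (a b : R) : cis (a + b) = cis a * cis b.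
Proof. by rewrite /cis cosD sinD; apply/eqP; rewrite eq_complex/= addrC eqxx/= addrC. Qed.

Lemma cis0 (R : realType) : cis 0 = 1 :> R[i].
Proof. by rewrite /cis cos0 sin0. Qed.

Lemma normc_cis (R : realType) (a : R) : normc (cis a) = 1.
Proof. by rewrite /= cos2Dsin2 sqrtr1. Qed.

Lemma normc_cisM (R : realType) (a : R) (z : R[i]) : normc (cis a * z) = normc z.
Proof. by rewrite normcM normc_cis mul1r. Qed.

(** The squared distance is 2 - 2 cos (a - b), bounded by [cos_ge]. *)
Lemma normc_cisB (R : realType) (a b : R) : normc (cis a - cis b) <= `|a - b|.
Proof.
rewrite -(ler_pXn2r (_ : 0 < 2)%N) ?nnegrE ?normc_ge0// normc_sqr/=.
rewrite real_normK ?num_real//.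
have := cos_ge (a - b); rewrite cosB.
have := cos2Dsin2 a; have := cos2Dsin2 b; nra.
Qed.

(** * A single level: signal, noise and the maximum of the Fourier sum *)

Definition fourier (R : realType) (N : nat) (Z : 'I_N -> R[i]) (t : R) : R[i] :=
  (N%:R^-1)%:C * \sum_(n < N) Z n * cis (n%:R * t).

(** Completing the square in r: the loss is quadratic in r and [fourier] at theta tau is its optimal
    amplitude. *)
Lemma qcels_lossE (R : realType) (N : nat) (tau : R) (Z : 'I_N -> R[i])
    (r : R[i]) (theta : R) : (0 < N)%N ->
  qcels_loss tau Z r theta =
  N%:R^-1 * \sum_(n < N) normc (Z n) ^+ 2
  - normc (fourier Z (theta * tau)) ^+ 2
  + normc (r - fourier Z (theta * tau)) ^+ 2.
Proof.
move=> N0; have N0' : N%:R != 0 :> R by rewrite pnatr_eq0 -lt0n.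
rewrite /qcels_loss !normc_sqr.
set F := fourier _ _.
have eRe : \sum_(n < N) (complex.Re (Z n) * cos (n%:R * (theta * tau)) -
    complex.Im (Z n) * sin (n%:R * (theta * tau))) = N%:R * complex.Re F.
  rewrite /F /fourier complex_ReM/= mul0r subr0 mulVKf// complex_Re_sum.
  by apply: eq_bigr => n _; rewrite complex_ReM.
have eIm : \sum_(n < N) (complex.Re (Z n) * sin (n%:R * (theta * tau)) +
    complex.Im (Z n) * cos (n%:R * (theta * tau))) = N%:R * complex.Im F.
  rewrite /F /fourier complex_ImM/= mul0r addr0 mulVKf// complex_Im_sum.
  by apply: eq_bigr => n _; rewrite complex_ImM.
rewrite (eq_bigr (fun n : 'I_N => normc (Z n) ^+ 2 + (normc r ^+ 2
   - 2 * (complex.Re r * (complex.Re (Z n) * cos (n%:R * (theta * tau)) -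
    complex.Im (Z n) * sin (n%:R * (theta * tau))) + complex.Im r *
   (complex.Re (Z n) * sin (n%:R * (theta * tau)) +
    complex.Im (Z n) * cos (n%:R * (theta * tau))))))); last first.
  move=> n _; rewrite !normc_sqr /cis cosN sinN.
  rewrite (_ : theta * n%:R * tau = n%:R * (theta * tau)); last by ring.
  have := cos2Dsin2 (n%:R * (theta * tau)).
  case: (Z n) r => [a b] [p q] /=.
  set c := cos _; set s := sin _ => cs.
  apply/eqP; rewrite -subr_eq0; apply/eqP.
  transitivity ((p ^+ 2 + q ^+ 2) * (c ^+ 2 + s ^+ 2 - 1)); first by ring.
  by rewrite cs subrr mulr0.
rewrite big_split/= sumrB sumr_const card_ord -mulr_sumr big_split/=.
rewrite -!mulr_sumr eRe eIm normc_sqr -[_ *+ N]mulr_natr.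
case: F {eRe eIm} => fa fb; case: r => ra rb /=.
by field.
Qed.

Lemma fourier_argmax (R : realType) (N : nat) (tau : R) (Z : 'I_N -> R[i])
    (r : R[i]) (theta theta' : R) : (0 < N)%N ->
  qcels_loss tau Z r theta <=
    qcels_loss tau Z (fourier Z (theta' * tau)) theta' ->
  normc (fourier Z (theta' * tau)) <= normc (fourier Z (theta * tau)).
Proof.
move=> N0; rewrite !qcels_lossE// subrr normc0 expr0n/= addr0.
have := sqr_ge0 (normc (r - fourier Z (theta * tau))).
set a := normc (r - _); set b := normc (fourier _ (theta * _)).
set c := normc (fourier _ _) => a0 h.
by rewrite -(ler_pXn2r (_ : 0 < 2)%N) ?nnegrE ?normc_ge0//; lra.
Qed.

Definition cfourier (R : realType) (N : nat) (Z : 'I_N -> R[i]) (x : R) : R[i] :=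
  (N%:R^-1)%:C * \sum_(n < N) Z n * cis (x * centered R N n).

(** Multiplying the data by the phases of u moves the frequency u to 0. Centering costs a global
    phase, invisible to the modulus. *)
Lemma normc_fourier (R : realType) (N : nat) (Z : 'I_N -> R[i]) (t u : R) :
  (0 < N)%N ->
  normc (fourier Z t) =
  normc (cfourier (fun n => Z n * cis (n%:R * u)) (N%:R * (t - u))).
Proof.
move=> N0; have N0' : N%:R != 0 :> R by rewrite pnatr_eq0 -lt0n.
rewrite -(normc_cisM ((N%:R - 1) / 2 * (t - u)) (cfourier _ _)).
rewrite /cfourier mulrCA mulr_sumr; congr (normc (_ * _)).
apply: eq_bigr => n _.
rewrite (_ : n%:R * t = (N%:R - 1) / 2 * (t - u) +
  (n%:R * u + N%:R * (t - u) * centered R N n)); last by rewrite /centered; field.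
by rewrite !cisD; ring.
Qed.

Lemma cfourierD (R : realType) (N : nat) (Z1 Z2 : 'I_N -> R[i]) (x : R) :
  cfourier (fun n => Z1 n + Z2 n) x = cfourier Z1 x + cfourier Z2 x.
Proof.
rewrite /cfourier -mulrDr -big_split/=; congr (_ * _).
by apply: eq_bigr => n _; rewrite mulrDl.
Qed.

Lemma cfourier_sum (R : realType) (N : nat) (I : finType) (P : pred I)
    (Z : I -> 'I_N -> R[i]) (x : R) :
  cfourier (fun n => \sum_(i | P i) Z i n) x = \sum_(i | P i) cfourier (Z i) x.
Proof.
rewrite /cfourier -mulr_sumr exchange_big/=; congr (_ * _).
by apply: eq_bigr => n _; rewrite mulr_suml.
Qed.

Lemma cfourierZ (R : realType) (N : nat) (a : R[i]) (Z : 'I_N -> R[i]) (x : R) :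
  cfourier (fun n => a * Z n) x = a * cfourier Z x.
Proof.
rewrite /cfourier [RHS]mulrCA; congr (_ * _); rewrite [RHS]mulr_sumr.
by apply: eq_bigr => n _; rewrite [RHS]mulrA.
Qed.

Lemma normc_cfourier (R : realType) (N : nat) (Z : 'I_N -> R[i]) (x : R) :
  normc (cfourier Z x) <= N%:R^-1 * \sum_(n < N) normc (Z n).
Proof.
rewrite /cfourier normcM normc_real_ge0 ?invr_ge0// ler_wpM2l ?invr_ge0//.
apply: le_trans (normc_sum _ _ _) _; apply: ler_sum => n _.
by rewrite normcM normc_cis mulr1.
Qed.

Lemma centered_le (R : realType) (N : nat) (n : 'I_N) : `|centered R N n| <= 1 / 2.
Proof.
have N0 : (0 < N)%N by exact: leq_trans (ltn_ord n).
have NR : 0 < N%:R :> R by rewrite ltr0n.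
have nN : n%:R + 1 <= N%:R :> R by rewrite natr1 ler_nat.
have n0 : 0 <= n%:R :> R by [].
rewrite /centered normrM normfV (ger0_norm (ltW NR)) ler_pdivrMr// ler_norml.
by apply/andP; split; lra.
Qed.

(** Centering bounds the frequencies by 1/2. This carries the bounds on the noise from the grid to
    all x. *)
Lemma cfourier_lip (R : realType) (N : nat) (Z : 'I_N -> R[i]) (x y : R) :
  normc (cfourier Z x - cfourier Z y) <=
  `|x - y| / 2 * (N%:R^-1 * \sum_(n < N) normc (Z n)).
Proof.
rewrite /cfourier -mulrBr -sumrB normcM normc_real_ge0 ?invr_ge0// mulrCA.
rewrite ler_wpM2l ?invr_ge0// mulr_sumr.
apply: le_trans (normc_sum _ _ _) _; apply: ler_sum => n _.
rewrite -mulrBr normcM mulrC ler_wpM2r ?normc_ge0//.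
apply: le_trans (normc_cisB _ _) _; rewrite -mulrBl normrM.
by rewrite ler_wpM2l// (le_trans (centered_le _ _))// div1r.
Qed.

Lemma cfourier1 (R : realType) (N : nat) (x : R) :
  cfourier (fun _ : 'I_N => 1) x = (dirichlet N x)%:C.
Proof.
rewrite /cfourier /dirichlet rmorphM/=; congr (_ * _).
under eq_bigr do rewrite mul1r.
apply/eqP; rewrite eq_complex complex_Re_sum complex_Im_sum/= eqxx/=.
by apply/eqP; exact: sum_sin_centered.
Qed.

Lemma Re_cfourier_cis (R : realType) (N : nat) (y : R) : (1000 <= N)%N ->
  - (26 / 100) <= complex.Re (cfourier (fun n : 'I_N => cis (n%:R * y)) 0).
Proof.
move=> N1000; rewrite /cfourier complex_ReM/= mul0r subr0 complex_Re_sum.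
under eq_bigr do rewrite mul0r cis0 mulr1/=.
exact: mean_cos_ge.
Qed.

(* Phases are relative to those of the target eigenvalue: [y ord0 = 0]. *)
Lemma signal_decomp (R : realType) (M N : nat) (p y : 'I_M.+1 -> R) (x : R) :
  (1000 <= N)%N -> (forall m, 0 <= p m) -> \sum_m p m = 1 -> y ord0 = 0 ->
  exists R_ : R -> R[i],
    [/\ forall x, cfourier (fun n : 'I_N => \sum_m (p m)%:C * cis (n%:R * y m)) x =
          (p ord0 * dirichlet N x)%:C + R_ x,
        forall x, normc (R_ x) <= 1 - p ord0
      & - (26 / 100 * (1 - p ord0)) <= complex.Re (R_ 0)].
Proof.
move=> N1000 p0 p1 y0.
have N0 : (0 < N)%N by exact: leq_trans N1000.
have N0' : N%:R != 0 :> R by rewrite pnatr_eq0 -lt0n.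
have ps : 1 - p ord0 = \sum_(m | m != ord0) p m.
  by rewrite -p1 (bigD1 ord0)//= addrC addrK.
exists (fun x => \sum_(m | m != ord0)
  (p m)%:C * cfourier (fun n : 'I_N => cis (n%:R * y m)) x); split.
- move=> z; rewrite cfourier_sum (bigD1 ord0)//= cfourierZ; congr (_ + _).
    rewrite rmorphM/= -cfourier1; congr (_ * _); rewrite /cfourier y0.
    by under eq_bigr do rewrite mulr0 cis0.
  by apply: eq_bigr => m _; rewrite cfourierZ.
- move=> z; rewrite ps; apply: le_trans (normc_sum _ _ _) _.
  apply: ler_sum => m _; rewrite normcM normc_real_ge0// ler_piMr//.
  apply: le_trans (normc_cfourier _ _) _.
  under eq_bigr do rewrite normc_cis.
  by rewrite sumr_const card_ord mulVf.
- rewrite ps complex_Re_sum mulr_sumr -sumrN; apply: ler_sum => m _.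
  rewrite complex_ReM/= mul0r subr0 mulrC -mulrN ler_wpM2l//.
  exact: Re_cfourier_cis.
Qed.

(** The numerical contradiction behind [level_fine]: P is p_0, Q is x ^ 2, u is N ^ -2, s is the
    kernel at x, a is |p_0 + noise(0)| and m is delta |x|. The loss (1 - s) P of the main term must
    exceed the gain 1.26 (1 - P) of the other eigenvalues. The constants 74/10 and 1/50 are adjusted
    to each other: at Q = 16 the margin is below one percent. *)
Lemma fine_arith (R : realFieldType) (P Q u s a m : R) :
  71 / 100 < P -> (74 / 10) ^+ 2 * (1 - P) <= Q -> 0 < Q -> Q < 81 / 4 ->
  s <= 1 -> P <= 1 -> u <= 1 / 1000 ->
  s <= 1 - Q / 24 * (1 - u) + Q ^+ 2 / (24 * 80) -> m <= Q ->
  P - (1 / 50) ^+ 2 <= a ->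
  a - (26 / 100 + 2 * (1 / 50) ^+ 2) * (1 - P) <=
    s * a + (1 - s) * (1 / 50) ^+ 2 + (1 - P) + m * (1 / 50) ^+ 2 -> False.
Proof.
move=> P71 Pb Q0 q2 s1 P1 u1 sT dq aP h1.
have h2 : (1 - s) * (P - 2 * (1 / 50) ^+ 2) <=
    (126 / 100 + 2 * (1 / 50) ^+ 2) * (1 - P) + Q * (1 / 50) ^+ 2.
  have : (1 - s) * (P - (1 / 50) ^+ 2) <= (1 - s) * a by rewrite ler_wpM2l// subr_ge0.
  by clear -h1 dq; lra.
clear h1 dq aP.
have h3 : Q * (1 / 24 * (1 - 1 / 1000) - Q / (24 * 80)) <= 1 - s.
  have : Q * u <= Q * (1 / 1000) by rewrite ler_pM2l.
  by clear -sT; lra.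
clear sT u1.
(* Up to 16, 1 - P is bounded by Q / 7.4 ^ 2 and everything is compared to Q. Beyond 16, 1 - P <
   0.29 is used, and the lower bound on 1 - s, increasing in Q on this range, is taken at 16. *)
have [Q16|Q16] := leP Q 16.
  have h4 : Q * (1 / 24 * (1 - 1 / 1000) - 16 / (24 * 80)) <= 1 - s.
    by clear -h3 Q16 Q0; nra.
  have h5 : 1 - 16 / (74 / 10) ^+ 2 <= P by clear -Pb Q16; lra.
  have : (1 - s) * (1 - 16 / (74 / 10) ^+ 2 - 2 * (1 / 50) ^+ 2) <=
      (1 - s) * (P - 2 * (1 / 50) ^+ 2).
    by rewrite ler_wpM2l ?subr_ge0// lerD2r.
  by clear -h2 h4 Pb Q0; lra.
have h4 : 16 * (1 / 24 * (1 - 1 / 1000) - 16 / (24 * 80)) <= 1 - s.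
  by clear -h3 Q16 q2; nra.
have : (1 - s) * (71 / 100 - 2 * (1 / 50) ^+ 2) <= (1 - s) * (P - 2 * (1 / 50) ^+ 2).
  by rewrite ler_wpM2l ?subr_ge0// lerD2r ltW.
by clear -h2 h4 P71 q2; lra.
Qed.

Section level.
Variables (R : realType) (M N : nat) (p y : 'I_M.+1 -> R) (e : 'I_N -> R[i]).
Variable (x : R).
Hypothesis (N1000 : (1000 <= N)%N).
Hypothesis (p_ge0 : forall m, 0 <= p m).
Hypothesis (p_sum1 : \sum_m p m = 1).
Hypothesis (y0 : y ord0 = 0).
Hypothesis (p0 : 71 / 100 < p ord0).
Hypothesis (e_small : N%:R^-1 * \sum_(n < N) normc (e n) <= (1 / 50) ^+ 2).
Let Z (n : 'I_N) := \sum_m (p m)%:C * cis (n%:R * y m) + e n.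
Hypothesis (x_max : normc (cfourier Z 0) <= normc (cfourier Z x)).

Lemma dirichlet0 : dirichlet N 0 = 1 :> R.
Proof.
rewrite /dirichlet; under eq_bigr do rewrite mul0r cos0.
by rewrite sumr_const card_ord mulVf// pnatr_eq0 -lt0n (leq_trans _ N1000).
Qed.

(** Up to the noise, the modulus is at most 0.45 p_0 + (1 - p_0) at x and at least p_0 - 0.26 (1 -
    p_0) at 0. For p_0 = 0.71 these are about 0.61 and 0.634, and the gap widens with p_0. *)
Lemma level_coarse : `|x| <= 3 / 2 * pi * N%:R -> `|x| < 9 / 2.
Proof using N1000 p_ge0 p_sum1 y0 p0 e_small x_max.
move=> xN; rewrite ltNge; apply/negP => x9.
have hD : `|dirichlet N x| <= 9 / 20 by apply: dirichlet_far; rewrite // x9.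
have [R_ [hR R1 R0]] := signal_decomp x N1000 p_ge0 p_sum1 y0.
move: x_max; rewrite /Z !cfourierD !hR dirichlet0 mulr1.
have g0 : normc (cfourier e 0) <= (1 / 50) ^+ 2 := le_trans (normc_cfourier _ _) e_small.
have gx : normc (cfourier e x) <= (1 / 50) ^+ 2 := le_trans (normc_cfourier _ _) e_small.
apply/negP; rewrite -ltNge.
apply: (@le_lt_trans _ _ (p ord0 * `|dirichlet N x| + (1 - p ord0) + (1 / 50) ^+ 2)).
  apply: le_trans (le_normcD _ _) _; apply: lerD => //.
  apply: le_trans (le_normcD _ _) _; apply: lerD => //.
  by rewrite normc_real normrM ger0_norm.
apply: lt_le_trans (le_trans (ler_norm _) (normRe_le _)).
rewrite !complex_ReD/=.
have := normRe_le (cfourier e 0); rewrite ler_norml => /andP[h _].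
have pp := p_ge0 ord0.
have : p ord0 * `|dirichlet N x| <= p ord0 * (9 / 20) by rewrite ler_wpM2l.
move: h g0 R0 pp p0; set n1 := normc _; set r1 := complex.Re _; set r2 := complex.Re _.
set d := `|_|; set P := p _; move=> h g0 R0 pp p0' hd.
by lra.
Qed.

(* Adding the noise g at the target to the real amplitude p_0 before taking moduli
   leaves only the difference g(x) - g(0), which is O(|x|); comparing moduli
   termwise would leave an error of order |g(0)|, too large for small delta.
   The factor 74/10 is admissible since 7.4 * sqrt (1 - 0.71) <= 4. *)
Lemma level_fine (delta : R) : 0 < delta -> delta <= `|x| -> `|x| < 9 / 2 ->
  (74 / 10) ^+ 2 * (1 - p ord0) <= delta ^+ 2 ->
  normc (cfourier e x - cfourier e 0) <= delta * `|x| * (1 / 50) ^+ 2 -> False.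
Proof using N1000 p_ge0 p_sum1 y0 p0 e_small x_max.
move=> d0 dx x9 dp dG.
have N0 : (0 < N)%N by exact: leq_trans N1000.
have [R_ [hR R1 R0]] := signal_decomp x N1000 p_ge0 p_sum1 y0.
move: x_max; rewrite /Z !cfourierD !hR dirichlet0 mulr1.
have g0 : normc (cfourier e 0) <= (1 / 50) ^+ 2 := le_trans (normc_cfourier _ _) e_small.
move: (cfourier e 0) (cfourier e x) g0 dG => g g' g0 dG.
have P71 := p0; set s := dirichlet N x; set P := p ord0 in P71 dp R1 R0 *.
set a := normc (P%:C + g).
have aP : P - (1 / 50) ^+ 2 <= a.
  have P0 : 0 <= P by lra.
  rewrite -(normc_real_ge0 P0).
  rewrite lerBlDr (_ : P%:C = (P%:C + g) + (- g)); last by rewrite addrK.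
  by apply: le_trans (le_normcD _ _) _; rewrite normcN lerD.
(* Projection onto the direction of P + g rather than onto the real axis. The imaginary parts of g
   and [R_ 0] contribute at most (1/50)^2 (1 - P) / a, and a >= 1/2 yields the factor 2. *)
have lb : a - (26 / 100 + 2 * (1 / 50) ^+ 2) * (1 - P) <= normc (P%:C + R_ 0 + g).
  have a0 : 0 < a by lra.
  rewrite -(ler_pM2l a0).
  have := normRe_le (conjc (P%:C + g) * (P%:C + R_ 0 + g)).
  have -> : normc (conjc (P%:C + g) * (P%:C + R_ 0 + g)) =
     a * normc (P%:C + R_ 0 + g).
    rewrite normcM; congr (_ * _); rewrite /a.
    by case: (P%:C + g) => ? ? /=; rewrite sqrrN.
  move=> /(le_trans (ler_norm _)); apply: le_trans.
  have a2 : a ^+ 2 = (P + complex.Re g) ^+ 2 + complex.Im g ^+ 2.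
    by rewrite /a normc_sqr complex_ReD complex_ImD/= add0r.
  have := normRe_le g; have := normIm_le g; have := R1 0.
  have := normIm_le (R_ 0).
  rewrite complex_ReM !complex_ReD !complex_ImD.
  clearbody a; case: (R_ 0) (R0) g g0 a2 {dG} => ra rb /= R0' [ga gb] /= g0 a2.
  rewrite !ler_norml => /andP[r1 r2] r3 /andP[i1 i2] /andP[e1 e2].
  have Pa : P + ga <= a.
    by rewrite -(ler_pXn2r (_ : 0 < 2)%N) ?nnegrE ?a2 ?lerDl ?sqr_ge0//; lra.
  have /andP[k1 _] : - ((1 / 50) ^+ 2 * (1 - P)) <= gb * rb <= (1 / 50) ^+ 2 * (1 - P).
    by rewrite -ler_norml normrM ler_pM ?ler_norml//; apply/andP; split; lra.
  have Pa0 : 0 <= P + ga by lra.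
  have rho0 : 0 <= 1 - P by lra.
  have k2 : (P + ga) * - (26 / 100 * (1 - P)) <= (P + ga) * ra by rewrite ler_wpM2l.
  have k3 : (P + ga) * (26 / 100 * (1 - P)) <= a * (26 / 100 * (1 - P)).
    by rewrite ler_wpM2r// mulr_ge0.
  have k4 : 2^-1 * (1 - P) <= a * (1 - P) by rewrite ler_wpM2r//; lra.
  by lra.
move=> hx; have {hx} := le_trans lb hx.
have Nbig : N%:R ^- 2 <= 1 / 1000 :> R.
  have NR : 1000 <= N%:R :> R by rewrite ler_nat.
  have N0' : N%:R != 0 :> R by rewrite pnatr_eq0 -lt0n.
  rewrite -exprVn; have := mulfV N0'.
  have : 0 <= N%:R^-1 :> R by rewrite invr_ge0.
  move: N%:R^-1 => v v0 Nv.
  have : 1000 * v <= N%:R * v by rewrite ler_wpM2r.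
  by nra.
have sT := dirichlet_taylor x N0.
have sL := dirichlet_ge x N0.
rewrite -/s in sT sL.
set q := `|x|; rewrite -/q in dx x9 dG.
have q0 : 0 < q by exact: lt_le_trans dx.
have xq2 : x ^+ 2 = q ^+ 2 by rewrite /q real_normK ?num_real.
have xq4 : x ^+ 4 = (q ^+ 2) ^+ 2 by rewrite -xq2; ring.
rewrite xq2 xq4 in sT sL.
have q2 : q ^+ 2 < 81 / 4 by nra.
(* From [sL], since q ^ 2 < 81 / 4 < 24. *)
have s0 : 0 <= s by lra.
have s1 : s <= 1 by have := dirichlet_le1 x N0; rewrite -/s ler_norml => /andP[].
have ub : normc ((P * s)%:C + R_ x + g') <=
    s * a + (1 - s) * (1 / 50) ^+ 2 + (1 - P) + delta * q * (1 / 50) ^+ 2.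
  (* The vector P + g of the value at 0 reappears, scaled by s, so that its modulus a can be
     compared on both sides. *)
  rewrite (_ : _ + g' = s%:C * (P%:C + g) + (1 - s)%:C * g + R_ x + (g' - g)).
    2: by rewrite (rmorphM (real_complex R)) (rmorphB (real_complex R)) rmorph1; ring.
  apply: le_trans (le_normcD _ _) _; apply: lerD => //.
  apply: le_trans (le_normcD _ _) _; apply: lerD => //.
  apply: le_trans (le_normcD _ _) _; rewrite !normcM !normc_real_ge0// ?subr_ge0//.
  by rewrite lerD2l ler_wpM2l ?subr_ge0.
move=> /le_trans /(_ ub) h1.
have dq : delta * q <= q ^+ 2 by rewrite expr2 ler_wpM2r// ltW.
have dq2 : delta ^+ 2 <= q ^+ 2 by rewrite ler_pXn2r ?nnegrE// ltW.
apply: (fine_arith P71 (le_trans dp dq2) (exprn_gt0 2 q0) q2 s1 _ Nbig sT dq aP h1).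
by rewrite -subr_ge0; apply: le_trans (normc_ge0 _) (R1 0).
Qed.

End level.

(** * Spectral decomposition of the autocorrelation *)

(** [cos_coeff] vanishes at odd k and [sin_coeff] at even k, so each term of the exponential series
    feeds exactly one of the two series. *)
Lemma expi_coeff (R : realType) (u : R) (k : nat) :
  (k`!%:R : R[i])^-1 * (0 +i* u) ^+ k = cos_coeff u k +i* sin_coeff u k.
Proof.
have -> : (k`!%:R : R[i])^-1 = ((k`!%:R : R)^-1)%:C.
  by rewrite fmorphV rmorph_nat.
have sq : (0 +i* u) ^+ 2 = (- u ^+ 2)%:C.
  by rewrite expr2; apply/eqP; rewrite eq_complex/= !(mul0r, mulr0, addr0, sub0r, eqxx).
have pw (j : nat) : (0 +i* u) ^+ j.*2 = ((-1) ^+ j * u ^+ j.*2)%:C.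
  by rewrite -mul2n exprM sq -rmorphXn/= exprM -exprMn mulN1r.
rewrite -(odd_double_half k) /cos_coeff /sin_coeff/=.
have sgn (j : nat) : (-1) ^ j = (-1) ^+ j :> R by [].
case: (odd k); rewrite /= ?add0n ?add1n ?exprS pw ?uphalf_double ?odd_double/=.
  apply/eqP; rewrite eq_complex/= doubleK sgn; apply/andP; split; apply/eqP; by ring.
rewrite doubleK sgn mul1r mul0r mul0r mul0r mulrC -rmorphM/=; congr (_ +i* _).
Qed.

Lemma cvg_expi (R : realType) (u : R) :
  ((fun n => complex.Re (\sum_(k < n) (k`!%:R : R[i])^-1 * (0 +i* u) ^+ k) : R)
     @ \oo --> cos u) /\
  ((fun n => complex.Im (\sum_(k < n) (k`!%:R : R[i])^-1 * (0 +i* u) ^+ k) : R)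
     @ \oo --> sin u).
Proof.
split.
- have -> : (fun n => complex.Re (\sum_(k < n) (k`!%:R : R[i])^-1 * (0 +i* u) ^+ k)) =
      series (cos_coeff u).
    apply/funext => n; rewrite complex_Re_sum /series/= big_mkord.
    by apply: eq_bigr => k _; rewrite expi_coeff.
  by rewrite cos.unlock; exact: is_cvg_series_cos_coeff.
- have -> : (fun n => complex.Im (\sum_(k < n) (k`!%:R : R[i])^-1 * (0 +i* u) ^+ k)) =
      series (sin_coeff u).
    apply/funext => n; rewrite complex_Im_sum /series/= big_mkord.
    by apply: eq_bigr => k _; rewrite expi_coeff.
  by rewrite sin.unlock; exact: is_cvg_series_sin_coeff.
Qed.

Section spectral.
Local Open Scope sesquilinear_scope.
Variables (R : realType) (d : nat) (H : 'M[R[i]]_d.+1).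
Variables (psi : 'I_d.+1 -> 'cV[R[i]]_d.+1) (lambda : 'I_d.+1 -> R).
Hypothesis psi_on : forall m m', braket (psi m) (psi m') = (m == m')%:R.
Hypothesis psi_eig : forall m, H *m psi m = (lambda m)%:C *: psi m.

(** Orthonormality reads U^* U = 1 for the matrix U with columns [psi m]; as U is square, U U^* = 1,
    which is completeness. *)
Lemma eigenbasis_resolution : \sum_m psi m *m (psi m) ^t* = 1%:M.
Proof using psi_on.
pose U : 'M[R[i]]_d.+1 := \matrix_(i, m) psi m i 0.
have <- : U *m U ^t* = 1%:M.
  apply: mulmx1C; apply/matrixP => m m'; rewrite !mxE -psi_on /braket mxE.
  by apply: eq_bigr => i _; rewrite !mxE.
apply/matrixP => i j; rewrite summxE !mxE; apply: eq_bigr => m _.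
by rewrite !mxE big_ord1 !mxE.
Qed.

Let expm (t : R) (m : 'I_d.+1) (n : nat) : R[i] :=
  \sum_(k < n) (k`!%:R)^-1 * (0 +i* - (lambda m * t)) ^+ k.

Lemma mexp_partialE (t : R) (n : nat) :
  mexp_partial ((0 +i* - t) *: H) n =
  \sum_m expm t m n *: (psi m *m (psi m) ^t*).
Proof using psi_on psi_eig.
have eig1 (k : nat) m : ((0 +i* - t) *: H) ^+ k *m psi m =
    (0 +i* - (lambda m * t)) ^+ k *: psi m.
  elim: k => [|k IH]; first by rewrite !expr0 mul1mx scale1r.
  rewrite exprSr -mulmxA -scalemxAl psi_eig scalerA -scalemxAr IH scalerA.
  congr (_ *: _); rewrite exprS; congr (_ * _).
  by apply/eqP; rewrite eq_complex/=; apply/andP; split; apply/eqP; ring.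
rewrite -[LHS]mulmx1 -eigenbasis_resolution mulmx_sumr; apply: eq_bigr => m _.
rewrite mulmxA scalemxAl; congr (_ *m _).
rewrite /mexp_partial mulmx_suml /expm scaler_suml; apply: eq_bigr => k _.
by rewrite -scalemxAl eig1 scalerA.
Qed.

Lemma mexpE (t : R) :
  mexp ((0 +i* - t) *: H) =
  \sum_m cis (- (lambda m * t)) *: (psi m *m (psi m) ^t*).
Proof using psi_on psi_eig.
apply/matrixP => i j; rewrite mxE summxE.
set w := fun m => (psi m *m (psi m) ^t*) i j.
have wE n : mexp_partial ((0 +i* - t) *: H) n i j = \sum_m expm t m n * w m.
  by rewrite mexp_partialE summxE; apply: eq_bigr => m _; rewrite mxE.
have -> : \sum_m (cis (- (lambda m * t)) *: (psi m *m (psi m) ^t*)) i j =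
  \sum_m cis (- (lambda m * t)) * w m by apply: eq_bigr => m _; rewrite mxE.
apply/eqP; rewrite eq_complex complex_Re_sum complex_Im_sum; apply/andP; split; apply/eqP.
- apply/cvg_lim => //.
  under eq_fun do rewrite wE complex_Re_sum.
  apply: cvg_big => [|m _]; first exact: add_continuous.
  under eq_fun do rewrite complex_ReM.
  rewrite complex_ReM; have [cc cs] := cvg_expi (- (lambda m * t)).
  by apply: cvgB; apply: cvgM => //; exact: cvg_cst.
- apply/cvg_lim => //.
  under eq_fun do rewrite wE complex_Im_sum.
  apply: cvg_big => [|m _]; first exact: add_continuous.
  under eq_fun do rewrite complex_ImM.
  rewrite complex_ImM; have [cc cs] := cvg_expi (- (lambda m * t)).
  by apply: cvgD; apply: cvgM => //; exact: cvg_cst.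
Qed.

Lemma braket_spectral (phi : 'cV[R[i]]_d.+1) (c : 'I_d.+1 -> R[i]) :
  braket phi ((\sum_m c m *: (psi m *m (psi m) ^t*)) *m phi) =
  \sum_m (normc (braket (psi m) phi) ^+ 2)%:C * c m.
Proof.
rewrite mulmx_suml /braket mulmx_sumr summxE.
apply: eq_bigr => m _; rewrite -scalemxAl -scalemxAr mxE mulrC; congr (_ * _).
rewrite -(mulmxA (psi m)) (mulmxA (phi ^t*)) mxE big_ord1.
have -> : (phi ^t* *m psi m) 0 0 = Num.conj ((psi m ^t* *m phi) 0 0).
  rewrite !mxE rmorph_sum; apply: eq_bigr => i _.
  by rewrite !mxE rmorphM/= conjCK mulrC.
by rewrite mulrC -sqr_normc rmorphXn.
Qed.

Lemma autocorrE (phi : 'cV[R[i]]_d.+1) (t : R) :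
  autocorr H phi t =
  \sum_m (normc (braket (psi m) phi) ^+ 2)%:C * cis (- (lambda m * t)).
Proof using psi_on psi_eig. by rewrite /autocorr mexpE braket_spectral. Qed.

Lemma sum_braket_sqr (phi : 'cV[R[i]]_d.+1) : braket phi phi = 1 ->
  \sum_m normc (braket (psi m) phi) ^+ 2 = 1.
Proof using psi_on.
move=> phi1; apply: (@complexI R); rewrite rmorph_sum/= -[RHS]phi1.
rewrite -[X in braket _ X](mul1mx phi) -eigenbasis_resolution.
under [in RHS]eq_bigr do rewrite -[X in X *m _]scale1r -scalemxAl.
by rewrite braket_spectral; apply: eq_bigr => m _; rewrite mulr1.
Qed.

End spectral.

(** * Hoeffding's inequality for independent signs *)

Definition sgnb (R : realType) (b : bool) : R := if b then 1 else -1.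

(** From exp (- v) >= 1 - v comes exp v <= 1 / (1 - v), and (1 + v + 2 v ^ 2) (1 - v) - 1 = v ^ 2 (1
    - 2 v). *)
Lemma expR_le_quad (R : realType) (v : R) : v <= 1 / 2 ->
  expR v <= 1 + v + 2 * v ^+ 2.
Proof.
move=> v2; have h := expR_ge1Dx (- v); have e0 := expR_gt0 v.
have e1 : expR v * expR (- v) = 1 by rewrite -expRD subrr expR0.
have v1 : 0 < 1 - v by lra.
have : expR v * (1 - v) <= 1 by rewrite -[leRHS]e1 ler_wpM2l ?expR_ge0.
move=> h2; rewrite -(ler_pM2r v1); apply: le_trans h2 _.
rewrite -subr_ge0.
have -> : (1 + v + 2 * v ^+ 2) * (1 - v) - 1 = v ^+ 2 * (1 - 2 * v) by ring.
by rewrite mulr_ge0 ?sqr_ge0//; lra.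
Qed.

(** A centered sign lies in [-2, 2], so |v| <= 1/4 keeps the exponents within the reach of
    [expR_le_quad]; the linear terms cancel in the mean. The restriction on v becomes the upper
    limit on t in [chernoff_signs]. *)
Lemma mgf_sign (R : realType) (q : bool -> R) (v : R) :
  (forall b, 0 <= q b) -> q true + q false = 1 -> `|v| <= 1 / 4 ->
  \sum_b q b * expR (v * (sgnb R b - (q true - q false))) <=
  expR (8 * v ^+ 2).
Proof.
move=> q0 q1; rewrite ler_norml => /andP[v1 v2].
rewrite big_bool/= /sgnb.
have qt := q0 true; have qf := q0 false.
have et : q true = 1 - q false by lra.
set f := q false in qf et q1 *; rewrite et.
apply: le_trans (expR_ge1Dx _).
have hx : v * (1 - (1 - f - f)) <= 1 / 2 by nra.
have hy : v * (- 1 - (1 - f - f)) <= 1 / 2 by nra.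
have f1 : f <= 1 by lra.
have f1' : 0 <= 1 - f by lra.
have h1 := ler_wpM2l f1' (expR_le_quad hx).
have h2 := ler_wpM2l qf (expR_le_quad hy).
apply: le_trans (lerD h1 h2) _.
rewrite -subr_ge0.
have -> : 1 + 8 * v ^+ 2 - ((1 - f) * (1 + v * (1 - (1 - f - f)) +
    2 * (v * (1 - (1 - f - f))) ^+ 2) +
   f * (1 + v * (-1 - (1 - f - f)) + 2 * (v * (-1 - (1 - f - f))) ^+ 2)) =
   8 * v ^+ 2 * (1 - f * (1 - f)) by ring.
rewrite mulr_ge0//; first by rewrite mulr_ge0 ?sqr_ge0.
by nra.
Qed.

(** Stated with product weights on sign vectors, so that the exponential moment factors by plain
    distributivity instead of through expectations of products. *)
Lemma chernoff_signs (R : realType) (I : finType) (q : I -> bool -> R)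
    (c : I -> R) (b t : R) :
  (forall i e, 0 <= q i e) -> (forall i, q i true + q i false = 1) ->
  (forall i, `|c i| <= b) -> 0 < b -> 0 <= t <= 4 * #|I|%:R * b -> (0 < #|I|)%N ->
  \sum_(s : {ffun I -> bool} |
      t <= \sum_i c i * (sgnb R (s i) - (q i true - q i false)))
     \prod_i q i (s i) <= expR (- (t ^+ 2 / (32 * #|I|%:R * b ^+ 2))).
Proof.
move=> q0 q1 cb b0 /andP[t0 t4] I0.
have n0 : 0 < #|I|%:R :> R by rewrite ltr0n.
set n := #|I|%:R in t4 n0 *.
(* The minimizer of - z t + 8 n (z b) ^ 2. *)
pose z := t / (16 * n * b ^+ 2).
have z0 : 0 <= z by rewrite divr_ge0// !mulr_ge0// ?sqr_ge0// ltW.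
have zb0 : 0 <= z * b by rewrite mulr_ge0 ?(ltW b0).
have zb : z * b <= 1 / 4.
  rewrite /z (_ : _ * b = t / (16 * n * b)); last by field; rewrite !gt_eqF.
  by rewrite ler_pdivrMr ?mulr_gt0//; lra.
pose L (s : {ffun I -> bool}) := \sum_i c i * (sgnb R (s i) - (q i true - q i false)).
apply: (@le_trans _ _ (\sum_s expR (z * (L s - t)) * \prod_i q i (s i))).
  rewrite big_mkcond/=; apply: ler_sum => s _.
  have pq : 0 <= \prod_i q i (s i) by apply: prodr_ge0.
  case: ifPn => [ts|_]; last by rewrite mulr_ge0 ?expR_ge0.
  rewrite ler_peMl// -[leLHS]expR0 ler_expR mulr_ge0// subr_ge0.
  exact: ts.
rewrite (eq_bigr (fun s : {ffun I -> bool} => expR (- (z * t)) *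
   \prod_i (q i (s i) * expR (z * c i * (sgnb R (s i) - (q i true - q i false))))));
  last first.
  move=> s _; rewrite big_split/= -expR_sum mulrBr expRD [RHS]mulrCA mulrC; congr (_ * _).
  rewrite mulrC; congr (_ * expR _).
  by rewrite /L mulr_sumr; apply: eq_bigr => i _; rewrite mulrA.
rewrite -mulr_sumr -(bigA_distr_bigA (fun i e => q i e * expR (z * c i *
   (sgnb R e - (q i true - q i false))))).
have cz i : `|z * c i| <= 1 / 4.
  by rewrite normrM ger0_norm//; apply: le_trans zb; rewrite ler_wpM2l.
apply: (@le_trans _ _ (expR (- (z * t)) * \prod_(i : I) expR (8 * (z * b) ^+ 2))).
  rewrite ler_wpM2l ?expR_ge0//; apply: ler_prod => i _; apply/andP; split.
    by apply: sumr_ge0 => e _; rewrite mulr_ge0 ?expR_ge0.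
  apply: le_trans (mgf_sign (q0 i) (q1 i) (cz i)) _.
  rewrite ler_expR ler_wpM2l// -(real_normK (num_real (z * c i))).
  rewrite ler_pXn2r ?nnegrE ?zb0 ?normr_ge0//.
  by rewrite normrM ger0_norm// ler_wpM2l.
rewrite -expR_sum sumr_const -expRD ler_expR -mulr_natr -/n.
rewrite le_eqVlt; apply/orP; left; apply/eqP.
by rewrite /z; field; rewrite !gt_eqF.
Qed.

Lemma probability_bigsetU_le (dsp : measure_display) (T : measurableType dsp)
    (R : realType) (P : probability T R) (I : Type) (s : seq I) (Q : pred I)
    (A : I -> set T) (u : I -> R) :
  (forall i, measurable (A i)) -> (forall i, Q i -> (P (A i) <= (u i)%:E)%E) ->
  (P (\big[setU/set0]_(i <- s | Q i) A i) <= (\sum_(i <- s | Q i) u i)%:E)%E.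
Proof.
move=> mA Au; elim: s => [|i s IH]; first by rewrite !big_nil measure0.
rewrite !big_cons; case: ifPn => // Qi.
have mB : measurable (\big[setU/set0]_(j <- s | Q j) A j).
  by apply: bigsetU_measurable => j _.
apply: le_trans (measureU2 _ (mA i) mB) _.
by rewrite EFinD leeD// Au.
Qed.

Section signs.
Variables (dsp : measure_display) (T : measurableType dsp) (R : realType).
Variables (P : probability T R) (I : finType) (X : I -> {RV P >-> R}).
Hypothesis X_sign : forall i w, X i w = 1 \/ X i w = -1.

Let q (i : I) (e : bool) : R := fine (P (X i @^-1` [set sgnb R e])).

Let mX (i : I) (B : set R) : measurable B -> measurable (X i @^-1` B).
Proof. by move=> mB; rewrite -[X in measurable X]setTI; exact: measurable_funP. Qed.

Let qE i e : P (X i @^-1` [set sgnb R e]) = (q i e)%:E.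
Proof. by rewrite /q fineK// fin_num_measure//; exact: mX. Qed.

Let q_ge0 i e : 0 <= q i e.
Proof. exact: fine_ge0. Qed.

Let X_cover i : X i @^-1` [set sgnb R false] = ~` (X i @^-1` [set sgnb R true]).
Proof.
apply/seteqP; split => w /=; first by move=> -> h; move: (h); lra.
by case: (X_sign i w) => ->.
Qed.

Let q_sum1 i : q i true + q i false = 1.
Proof.
apply/EFin_inj; rewrite EFinD -!qE X_cover probability_setC; last exact: mX.
by rewrite qE -EFinB -EFinD addrC subrK.
Qed.

Lemma expectation_sign i : ('E_P[X i] = (q i true - q i false)%:E)%E.
Proof.
have -> : ('E_P[X i] = 'E_P[(\1_(X i @^-1` [set sgnb R true]) \-
    \1_(X i @^-1` [set sgnb R false]))%R])%E.
  congr expectation; apply/funext => w.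
  change (X i w =
    \1_(X i @^-1` [set sgnb R true]) w - \1_(X i @^-1` [set sgnb R false]) w).
  have h e : (w \in X i @^-1` [set sgnb R e]) = (X i w == sgnb R e).
    by apply/idP/eqP => [/set_mem//|?]; exact: mem_set.
  have n1 : (1 == -1 :> R) = false by apply/eqP; lra.
  by rewrite !indicE !h /sgnb; case: (X_sign i w) => ->;
    rewrite eqxx ?n1 1?eq_sym ?n1 ?subr0 ?sub0r.
have L1 (A : set T) : measurable A -> \1_A \in Lfun P 1.
  by move=> mA; apply/Lfun1_integrable; exact: integrable_indic.
by rewrite expectationB ?L1 ?expectation_indic ?qE//; exact: mX.
Qed.

Lemma measurable_linear_ge (mu c : I -> R) (t : R) :
  measurable [set w | t <= \sum_i c i * (X i w - mu i)].
Proof.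
pose f w := \sum_i c i * (X i w - mu i).
have mf : measurable_fun setT f.
  apply: measurable_sum => i; apply: measurable_realfun.measurable_funM => //.
  exact: measurable_realfun.measurable_funB.
rewrite (_ : [set w | _] = setT `&` f @^-1` `[t, +oo[); first exact: mf.
by apply/seteqP; split => w /=; rewrite in_itv/= andbT// => -[].
Qed.

(** The event is covered by the finitely many sets on which the sign vector is fixed. Independence
    gives each of them its product weight, and [chernoff_signs] sums the weights. *)
Lemma hoeffding (mu c : I -> R) (b t : R) :
  (forall B : I -> set R, (forall i, measurable (B i)) ->
     P (\big[setI/setT]_i (X i @^-1` B i)) = (\prod_i P (X i @^-1` B i))%E) ->
  (forall i, ('E_P[X i] = (mu i)%:E)%E) ->
  (forall i, `|c i| <= b) -> 0 < b -> 0 <= t <= 4 * #|I|%:R * b -> (0 < #|I|)%N ->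
  (P [set w | (t <= \sum_i c i * (X i w - mu i))%R] <=
     (expR (- (t ^+ 2 / (32 * #|I|%:R * b ^+ 2))))%:E)%E.
Proof.
move=> indep Emu cb b0 tb I0.
have muE i : mu i = q i true - q i false.
  by apply/EFin_inj; rewrite -Emu expectation_sign.
pose Q := [pred s : {ffun I -> bool} | t <= \sum_i c i * (sgnb R (s i) - mu i)].
pose A (s : {ffun I -> bool}) := \big[setI/setT]_i (X i @^-1` [set sgnb R (s i)]).
have mA s : measurable (A s).
  by apply: bigsetI_measurable => i _; exact: mX.
have PA s : P (A s) = (\prod_i q i (s i))%:E.
  rewrite /A (indep (fun i => [set sgnb R (s i)]))//.
  by rewrite (big_morph EFin (@EFinM R) erefl); apply: eq_bigr => i _; exact: qE.
have sub : [set w | t <= \sum_i c i * (X i w - mu i)] `<=`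
    \big[setU/set0]_(s | Q s) A s.
  move=> w /= tw; pose s := [ffun i => X i w == 1].
  have sX i : sgnb R (s i) = X i w.
    by rewrite ffunE /sgnb; case: (X_sign i w) => ->; case: eqP; lra.
  rewrite -bigcup_seq_cond; exists s.
    by rewrite /= mem_index_enum/=; under eq_bigr do rewrite sX.
  by rewrite /A -bigcap_seq => i _ /=.
have mU : measurable (\big[setU/set0]_(s | Q s) A s).
  by apply: bigsetU_measurable => s _.
have mE := measurable_linear_ge mu c t.
apply: le_trans (le_measure _ _ _ sub) _; rewrite ?inE//.
have PAle s : Q s -> (P (A s) <= (\prod_i q i (s i))%:E)%E by rewrite PA.
apply: le_trans (probability_bigsetU_le _ mA PAle) _.
rewrite lee_fin; apply: le_trans (chernoff_signs q_ge0 q_sum1 cb b0 tb I0).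
rewrite le_eqVlt; apply/orP; left; apply/eqP; apply: eq_bigl => s /=.
by under eq_bigr do rewrite muE.
Qed.

End signs.

(** * Sampling noise *)

(** The units 1, -1, i and -i: the real parts of their products with z are, up to sign, the
    coordinates of z, so four linear forms control |z| up to a factor 2. *)
Definition unit4 (R : realType) (p : bool * bool) : R[i] :=
  if p.2 then (sgnb R p.1)%:C else 0 +i* sgnb R p.1.

Lemma normc_unit4 (R : realType) p : normc (unit4 R p) = 1.
Proof.
by case: p => -[] []; rewrite /unit4/= /sgnb ?expr0n ?sqrrN expr1n ?addr0 ?add0r sqrtr1.
Qed.

Lemma normc_le_unit4 (R : realType) (z : R[i]) (s : R) :
  (forall p, complex.Re (unit4 R p * z) <= s) -> normc z <= 2 * s.
Proof.
move=> h; apply: le_trans (normc_le_ReIm z) _.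
have := h (true, true); have := h (false, true).
have := h (true, false); have := h (false, false).
case: z {h} => x y; rewrite /unit4 /sgnb/= => h1 h2 h3 h4.
rewrite mulr_natl mulr2n lerD// ler_norml; apply/andP; split; lra.
Qed.

Section noise.
Variables (dsp : measure_display) (T : measurableType dsp) (R : realType).
Variables (P : probability T R) (N Ns : nat) (X Y : 'I_Ns -> 'I_N -> {RV P >-> R}).
Variable a : 'I_N -> R[i].
Hypotheses (N_gt0 : (0 < N)%N) (Ns_gt0 : (0 < Ns)%N).
Hypothesis XY_sign : forall k n w, (X k n w = 1 \/ X k n w = -1) /\
  (Y k n w = 1 \/ Y k n w = -1).
Hypothesis XY_mean : forall k n, ('E_P[X k n] = (complex.Re (a n))%:E)%E /\
  ('E_P[Y k n] = (complex.Im (a n))%:E)%E.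
Let W (i : 'I_Ns * 'I_N * bool) := if i.2 then X i.1.1 i.1.2 else Y i.1.1 i.1.2.
Hypothesis XY_indep : forall B : 'I_Ns * 'I_N * bool -> set R,
  (forall i, measurable (B i)) ->
  P (\big[setI/setT]_i (W i @^-1` B i)) = (\prod_i P (W i @^-1` B i))%E.

Definition noise (w : T) (n : 'I_N) : R[i] :=
  sample_mean (fun k n => X k n w) (fun k n => Y k n w) n - a n.

Let coef (v : 'I_N -> R[i]) (i : 'I_Ns * 'I_N * bool) : R :=
  if i.2 then complex.Re (v i.1.2) else - complex.Im (v i.1.2).
Let mu (i : 'I_Ns * 'I_N * bool) : R :=
  if i.2 then complex.Re (a i.1.2) else complex.Im (a i.1.2).

Let Ns0 : Ns%:R != 0 :> R. Proof. by rewrite pnatr_eq0 -lt0n. Qed.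

Lemma Re_sum_noise (v : 'I_N -> R[i]) (w : T) :
  complex.Re (\sum_n v n * noise w n) =
  Ns%:R^-1 * \sum_i coef v i * (W i w - mu i).
Proof.
have -> : \sum_i coef v i * (W i w - mu i) = \sum_n \sum_k
    (complex.Re (v n) * (X k n w - complex.Re (a n)) -
     complex.Im (v n) * (Y k n w - complex.Im (a n))).
  rewrite exchange_big/= pair_big/=.
  rewrite -(pair_big xpredT xpredT
    (fun (p : 'I_Ns * 'I_N) e => coef v (p, e) * (W (p, e) w - mu (p, e))))/=.
  apply: eq_bigr => -[k n] _; rewrite big_bool/= /coef /W /mu/=.
  by rewrite mulNr.
rewrite complex_Re_sum mulr_sumr; apply: eq_bigr => n _.
have -> : noise w n = (Ns%:R^-1 * \sum_k (X k n w - complex.Re (a n))) +i*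
    (Ns%:R^-1 * \sum_k (Y k n w - complex.Im (a n))).
  rewrite /noise /sample_mean.
  have -> : (Ns%:R : R[i])^-1 = (Ns%:R^-1)%:C by rewrite fmorphV rmorph_nat.
  apply/eqP; rewrite eq_complex complex_ReD complex_ImD complex_ReM complex_ImM.
  rewrite complex_Re_sum complex_Im_sum/= !sumrB !sumr_const card_ord.
  have h (A r : R) : Ns%:R^-1 * (A - r *+ Ns) = Ns%:R^-1 * A - r.
    by rewrite mulrBr -[r *+ Ns]mulr_natl mulKf.
  by rewrite !h !mul0r subr0 addr0; case: (a n) => ar ai /=; rewrite !eqxx.
rewrite complex_ReM/= mulrCA [X in _ - X]mulrCA -mulrBr; congr (_ * _).
by rewrite !mulr_sumr -sumrB.
Qed.

(** Hoeffding's bound for 2 N Ns signs at threshold Ns t, hence 64 = 32 * 2 and the upper limit 8 N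
    b on t. *)
Lemma noise_tail (v : 'I_N -> R[i]) (b t : R) :
  (forall n, `|complex.Re (v n)| <= b) -> (forall n, `|complex.Im (v n)| <= b) ->
  0 < b -> 0 <= t <= 8 * N%:R * b ->
  measurable [set w | t <= complex.Re (\sum_n v n * noise w n)] /\
  (P [set w | (t <= complex.Re (\sum_n v n * noise w n))%R] <=
     (expR (- (Ns%:R * t ^+ 2 / (64 * N%:R * b ^+ 2))))%:E)%E.
Proof.
move=> vR vI b0 /andP[t0 tb].
have NsR : 0 < Ns%:R :> R by rewrite ltr0n.
have NR : 0 < N%:R :> R by rewrite ltr0n.
have -> : [set w | (t <= complex.Re (\sum_n v n * noise w n))%R] =
    [set w | Ns%:R * t <= \sum_i coef v i * (W i w - mu i)].
  by apply/seteqP; split => w /=; rewrite Re_sum_noise ler_pdivlMl.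
have cI : #|{: 'I_Ns * 'I_N * bool}|%:R = Ns%:R * N%:R * 2 :> R.
  by rewrite !card_prod !card_ord card_bool !natrM.
split; first exact: measurable_linear_ge.
have Wsign i w : W i w = 1 \/ W i w = -1.
  by have [h1 h2] := XY_sign i.1.1 i.1.2 w; rewrite /W; case: i.2.
have Wmean i : ('E_P[W i] = (mu i)%:E)%E.
  by have [h1 h2] := XY_mean i.1.1 i.1.2; rewrite /W /mu; case: i.2.
have cb i : `|coef v i| <= b by rewrite /coef; case: i.2; rewrite ?normrN.
have I0 : (0 < #|{: 'I_Ns * 'I_N * bool}|)%N.
  by rewrite !card_prod !card_ord card_bool !muln_gt0 Ns_gt0 N_gt0.
have tI : 0 <= Ns%:R * t <= 4 * #|{: 'I_Ns * 'I_N * bool}|%:R * b.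
  rewrite mulr_ge0 ?(ltW NsR)//= cI.
  rewrite (_ : 4 * _ * b = Ns%:R * (8 * N%:R * b)); last by ring.
  by rewrite ler_wpM2l// ltW.
apply: le_trans (hoeffding Wsign XY_indep Wmean cb b0 tI I0) _.
rewrite cI lee_fin ler_expR le_eqVlt; apply/orP; left; apply/eqP.
by field; rewrite !gt_eqF.
Qed.

(* The sum of |Re| + |Im| is the maximum of 4 ^ N signed linear forms. *)
Lemma noise_coarse (kappa : R) : 0 < kappa <= 1 ->
  exists B : set T, [/\ measurable B,
    (P B <= (4 ^+ N * expR (- (kappa ^+ 2 * N%:R * Ns%:R / 64)))%:E)%E &
    forall w, ~ B w -> N%:R^-1 * \sum_n normc (noise w n) <= kappa].
Proof.
move=> /andP[k0 k1].
have NR : 0 < N%:R :> R by rewrite ltr0n.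
pose v (s : {ffun 'I_N -> bool * bool}) n : R[i] :=
  sgnb R (s n).1 +i* sgnb R (s n).2.
have sgn1 e : `|sgnb R e| <= 1 by case: e; rewrite /sgnb ?normrN normr1.
have tb : 0 <= kappa * N%:R <= 8 * N%:R * 1.
  by apply/andP; split; nra.
have tail s := @noise_tail (v s) 1 (kappa * N%:R)
  (fun n => sgn1 _) (fun n => sgn1 _) ltr01 tb.
exists (\big[setU/set0]_s
  [set w | kappa * N%:R <= complex.Re (\sum_n v s n * noise w n)]); split.
- by apply: bigsetU_measurable => s _; have [] := tail s.
- apply: le_trans (probability_bigsetU_le _ (fun s => (tail s).1)
    (fun s _ => (tail s).2)) _.
  rewrite lee_fin sumr_const card_ffun card_prod card_bool card_ord -[leLHS]mulr_natl.
  rewrite natrX ler_wpM2l// ler_expR le_eqVlt; apply/orP; left; apply/eqP.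
  by field; rewrite gt_eqF.
- move=> w wB; rewrite ler_pdivrMl// leNgt; apply/negP => big.
  apply: wB.
  (* The real part of v e is Re v Re e - Im v Im e, so the second sign is opposite to that of the
     imaginary part of the noise. *)
  pose s := [ffun n =>
    (0 <= complex.Re (noise w n), complex.Im (noise w n) <= 0)].
  rewrite -bigcup_seq; exists s; first exact: mem_index_enum.
  rewrite /= mulrC; apply: le_trans (ltW big) _.
  rewrite complex_Re_sum; apply: ler_sum => n _.
  apply: le_trans (normc_le_ReIm _) _.
  rewrite complex_ReM/= ffunE/= -mulNr /sgnb; apply: lerD.
    by case: ger0P => _ /=; lra.
  by case: ler0P => _ /=; lra.
Qed.

(** The coefficients cis (x c_n) - 1, with c_n the centered index, are O(|x|). At a threshold
    proportional to |x| the tail bound therefore does not depend on x, and all grid points cost the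
    same. *)
Lemma noise_fine (ph : 'I_N -> R[i]) (h s : R) (K : nat) :
  (forall n, normc (ph n) = 1) -> 0 < h -> 0 < s <= 8 ->
  exists B : set T, [/\ measurable B,
    (P B <= (8 * K%:R * expR (- (s ^+ 2 * N%:R * Ns%:R / 64)))%:E)%E &
    forall w, ~ B w -> forall (e : bool) (i : nat), (i <= K)%N ->
      let x := sgnb R e * (i%:R * h) in
      normc (cfourier (fun n => noise w n * ph n) x -
             cfourier (fun n => noise w n * ph n) 0) <= s * `|x| ].
Proof.
move=> ph1 h0 /andP[s0 s8].
have NR : 0 < N%:R :> R by rewrite ltr0n.
(* The grid starts at i = 1, the increment at 0 being zero. Two signs, K points and four units make
   8 K linear forms. *)
pose x (p : bool * 'I_K) := sgnb R p.1 * (p.2.+1%:R * h).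
have nx p : `|x p| = p.2.+1%:R * h.
  rewrite normrM (ger0_norm (mulr_ge0 _ (ltW h0)))//.
  by case: p.1; rewrite /sgnb ?normrN normr1 mul1r.
have x0 p : 0 < `|x p| by rewrite nx mulr_gt0.
pose v (p : bool * 'I_K * (bool * bool)) n :=
  unit4 R p.2 * (ph n * (cis (x p.1 * centered R N n) - 1)).
have vb p n : normc (v p n) <= `|x p.1| / 2.
  rewrite /v !normcM normc_unit4 ph1 !mul1r -(cis0 R).
  apply: le_trans (normc_cisB _ _) _; rewrite subr0 normrM.
  by rewrite ler_wpM2l// (le_trans (centered_le _ _))// div1r.
have vR p n := le_trans (normRe_le _) (vb p n).
have vI p n := le_trans (normIm_le _) (vb p n).
have b0 p : 0 < `|x p| / 2 by rewrite divr_gt0.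
(* The half compensates for the factor 2 lost in [normc_le_unit4]. *)
pose t (p : bool * 'I_K * (bool * bool)) := N%:R * (s * `|x p.1| / 2).
have tb p : 0 <= t p <= 8 * N%:R * (`|x p.1| / 2).
  rewrite /t !mulr_ge0 ?(ltW NR) ?(ltW s0)//=.
  rewrite (_ : 8 * _ * _ = N%:R * (8 * `|x p.1| / 2)); last by field.
  by rewrite ler_wpM2l ?(ltW NR)// ler_wpM2r// ler_wpM2r.
have tail p := noise_tail (vR p) (vI p) (b0 p.1) (tb p).
exists (\big[setU/set0]_p
  [set w | t p <= complex.Re (\sum_n v p n * noise w n)]); split.
- by apply: bigsetU_measurable => p _; have [] := tail p.
- apply: le_trans (probability_bigsetU_le _ (fun p => (tail p).1)
    (fun p _ => (tail p).2)) _.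
  rewrite lee_fin (eq_bigr (fun=> expR (- (s ^+ 2 * N%:R * Ns%:R / 64)))).
    rewrite sumr_const !card_prod !card_bool card_ord -[leLHS]mulr_natl !natrM.
    by rewrite ler_wpM2r ?expR_ge0// le_eqVlt; apply/orP; left; apply/eqP; ring.
  move=> p _; congr (expR (- _)); rewrite /t; field.
  by rewrite gt_eqF//= gt_eqF.
- move=> w wB e [|i] iK /=.
    by rewrite !mul0r mulr0 normr0 mulr0 subrr normc0.
  have e1 z : cfourier (fun n => noise w n * ph n) z -
      cfourier (fun n => noise w n * ph n) 0 =
      (N%:R^-1)%:C * \sum_n ph n * (cis (z * centered R N n) - 1) * noise w n.
    rewrite /cfourier -mulrBr -sumrB; congr (_ * _); apply: eq_bigr => n _.
    by rewrite mul0r cis0; ring.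
  rewrite e1 normcM normc_real_ge0 ?invr_ge0// ler_pdivrMl//.
  pose p0 : bool * 'I_K := (e, Ordinal iK).
  rewrite (_ : N%:R * _ = 2 * (N%:R * (s * `|x p0| / 2))); last first.
    by rewrite /x/=; field.
  apply: normc_le_unit4 => u; rewrite leNgt; apply/negP => big.
  apply: wB; rewrite -bigcup_seq; exists (p0, u); first exact: mem_index_enum.
  rewrite /= /t/=; apply: le_trans (ltW big) _.
  rewrite mulr_sumr le_eqVlt; apply/orP; left; apply/eqP; congr complex.Re.
  by apply: eq_bigr => n _; rewrite /v /x/= !mulrA.
Qed.

End noise.

(** * Induction over the levels *)

(** Rounding x to the grid moves it by at most delta ^ 2 <= delta |x|. By [cfourier_lip] this costs
    one half of the bound; the value on the grid costs the other half. *)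
Lemma cfourier_grid (R : realType) (N : nat) (e : 'I_N -> R[i]) (K : nat)
    (kappa delta : R) :
  N%:R^-1 * \sum_(n < N) normc (e n) <= kappa -> 0 < delta -> 0 <= kappa ->
  9 / 2 <= K%:R * delta ^+ 2 ->
  (forall (sg : bool) (i : nat), (i <= K)%N ->
      let x := sgnb R sg * (i%:R * delta ^+ 2) in
      normc (cfourier e x - cfourier e 0) <= kappa * delta / 2 * `|x|) ->
  forall x, delta <= `|x| -> `|x| < 9 / 2 ->
    normc (cfourier e x - cfourier e 0) <= delta * `|x| * kappa.
Proof.
move=> ek d0 k0 Kd grid x dx x9.
have d2 : 0 < delta ^+ 2 by rewrite exprn_gt0.
pose i := Num.truncn (`|x| / delta ^+ 2).
have /andP[i1 i2] : i%:R * delta ^+ 2 <= `|x| < i%:R * delta ^+ 2 + delta ^+ 2.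
  have : i%:R <= `|x| / delta ^+ 2 < i.+1%:R.
    by apply: truncn_itv; rewrite divr_ge0// ltW.
  by rewrite ler_pdivlMr// ltr_pdivrMr// -[i.+1%:R]natr1 mulrDl mul1r.
have iK : (i <= K)%N.
  rewrite -ltnS -(ltr_nat R) -[K.+1%:R]natr1 -(ltr_pM2r d2).
  by rewrite mulrDl mul1r; lra.
(* Rounding is towards 0, so that |y| <= |x|. *)
pose sg := 0 <= x; pose y := sgnb R sg * (i%:R * delta ^+ 2).
have i0 : 0 <= i%:R * delta ^+ 2 by rewrite mulr_ge0 ?(ltW d2).
have yx : `|y| <= `|x|.
  rewrite normrM (ger0_norm i0) /sgnb; by case: (sg); rewrite ?normrN normr1 mul1r.
have xy : `|x - y| <= delta ^+ 2.
  rewrite /y /sg /sgnb; case: ger0P i1 i2 => x0 i1 i2.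
    by rewrite ler_norml; apply/andP; split; lra.
  by rewrite ler_norml; apply/andP; split; lra.
have g1 := cfourier_lip e x y.
have g2 := grid sg i iK; rewrite -/y /= in g2.
rewrite (_ : _ - _ = (cfourier e x - cfourier e y) + (cfourier e y - cfourier e 0)).
  2: by rewrite addrA subrK.
apply: le_trans (le_normcD _ _) _.
have g3 : `|x - y| / 2 * (N%:R^-1 * \sum_(n < N) normc (e n)) <= delta * `|x| / 2 * kappa.
  apply: ler_pM => //.
    by rewrite mulr_ge0 ?invr_ge0//; apply: sumr_ge0 => n _; exact: normc_ge0.
  rewrite ler_wpM2r//; apply: le_trans xy _.
  by rewrite expr2 ler_wpM2l// ltW.
have g4 : kappa * delta / 2 * `|y| <= kappa * delta / 2 * `|x|.
  by rewrite ler_wpM2l// divr_ge0// mulr_ge0// ltW.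
apply: le_trans (lerD (le_trans g1 g3) (le_trans g2 g4)) _.
by rewrite le_eqVlt; apply/orP; left; apply/eqP; field.
Qed.

Section levels.
Variables (R : realType) (d : nat) (H : 'M[R[i]]_d.+1).
Variables (psi : 'I_d.+1 -> 'cV[R[i]]_d.+1) (lambda : 'I_d.+1 -> R).
Variables (phi : 'cV[R[i]]_d.+1) (N J : nat) (tau : nat -> R).
Variables (Z : nat -> 'I_N -> R[i]) (r : nat -> R[i]) (theta : nat -> R).
Hypothesis psi_on : forall m m', braket (psi m) (psi m') = (m == m')%:R.
Hypothesis psi_eig : forall m, H *m psi m = (lambda m)%:C *: psi m.
Hypothesis lambda0 : - pi <= lambda ord0 < pi.
Hypothesis phi1 : braket phi phi = 1.
Let p m := normc (braket (psi m) phi) ^+ 2.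
Hypothesis p0 : 71 / 100 < p ord0.
Hypothesis N1000 : (1000 <= N)%N.
Hypothesis tau_gt0 : forall j, 0 < tau j.
Hypothesis tauS : forall j, (1 <= j)%N -> tau j.+1 = 2 * tau j.
Hypothesis tau1 : N%:R * tau 1%N <= 4.
Hypothesis run : qcels_run J tau Z r theta.
Let e j n := Z j n - autocorr H phi (n%:R * tau j).
Hypothesis e_small : forall j, (1 <= j <= J)%N ->
  N%:R^-1 * \sum_(n < N) normc (e j n) <= (1 / 50) ^+ 2.

Definition offset j := N%:R * (theta j * tau j - lambda ord0 * tau j).
Let e' j (n : 'I_N) := e j n * cis (n%:R * (lambda ord0 * tau j)).
Let y j m := (lambda ord0 - lambda m) * tau j.

Let N0 : (0 < N)%N. Proof. exact: leq_trans N1000. Qed.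

Let e'_small j : (1 <= j <= J)%N ->
  N%:R^-1 * \sum_(n < N) normc (e' j n) <= (1 / 50) ^+ 2.
Proof.
move=> jJ; rewrite (eq_bigr (fun n => normc (e j n))) ?e_small// => n _.
by rewrite /e' normcM normc_cis mulr1.
Qed.

Let p_sum1 : \sum_m p m = 1. Proof. exact: sum_braket_sqr. Qed.

Let y0 j : y j ord0 = 0. Proof. by rewrite /y subrr mul0r. Qed.

Let x_max j : (1 <= j <= J)%N ->
  lambda_min tau theta j <= lambda ord0 <= lambda_max tau theta j ->
  normc (cfourier (fun n => \sum_m (p m)%:C * cis (n%:R * y j m) + e' j n) 0) <=
  normc (cfourier (fun n => \sum_m (p m)%:C * cis (n%:R * y j m) + e' j n) (offset j)).
Proof.
move=> jJ l0; have [_ rmin] := run jJ.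
have := fourier_argmax N0 (rmin (fourier (Z j) (lambda ord0 * tau j)) _ l0).
rewrite (normc_fourier _ _ (lambda ord0 * tau j) N0) subrr mulr0.
rewrite (normc_fourier _ (theta j * tau j) (lambda ord0 * tau j) N0) -/(offset j).
have -> : (fun n : 'I_N => Z j n * cis (n%:R * (lambda ord0 * tau j))) =
  (fun n => \sum_m (p m)%:C * cis (n%:R * y j m) + e' j n) => //.
apply/funext => n; rewrite /e' /e mulrBl.
suff -> : \sum_m (p m)%:C * cis (n%:R * y j m) =
  autocorr H phi (n%:R * tau j) * cis (n%:R * (lambda ord0 * tau j)).
  by rewrite addrC subrK.
rewrite (autocorrE psi_on psi_eig) mulr_suml; apply: eq_bigr => m _.
by rewrite -mulrA -cisD; congr (_ * cis _); rewrite /y; ring.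
Qed.

Lemma offset_lt j : (1 <= j <= J)%N ->
  lambda_min tau theta j <= lambda ord0 <= lambda_max tau theta j ->
  `|offset j| <= 3 / 2 * pi * N%:R -> `|offset j| < 9 / 2.
Proof.
move=> jJ l0; apply: (level_coarse N1000 _ p_sum1 (y0 j) p0 (e'_small jJ)).
  by move=> m; rewrite exprn_ge0 ?normc_ge0.
exact: x_max.
Qed.

Lemma offsetE j : offset j = N%:R * tau j * (theta j - lambda ord0).
Proof. by rewrite /offset; ring. Qed.

(** From |x| < 9/2 the error is below 9 / (2 N tau), less than pi / (2 tau), so the target stays in
    the next interval. There |x| <= N pi + 9, which is below 3/2 pi N since N >= 1000:
    [level_coarse] applies again, with no aliasing. *)
Lemma all_levels j : (1 <= j <= J)%N ->
  lambda_min tau theta j <= lambda ord0 <= lambda_max tau theta j /\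
  `|offset j| < 9 / 2.
Proof.
have NR : 1000 <= N%:R :> R by rewrite ler_nat.
have pi3 := pi_ge3 R.
case/andP: lambda0 => l1 l2.
elim: j => [//|[_|j IH]] jJ.
  have l0 : lambda_min tau theta 1 <= lambda ord0 <= lambda_max tau theta 1.
    by rewrite /lambda_min /lambda_max/= l1 ltW.
  split=> //; apply: offset_lt => //.
  have [] := run jJ; rewrite /lambda_min /lambda_max/= => /andP[t1 t2] _.
  rewrite offsetE normrM ger0_norm; last by rewrite mulr_ge0 ?(ltW (tau_gt0 _)).
  (* At the first level N tau <= 4, and two points of [-pi, pi] differ by at most 2 pi. *)
  apply: (@le_trans _ _ (4 * (2 * pi))); last by nra.
  apply: ler_pM => //; first by rewrite mulr_ge0 ?(ltW (tau_gt0 _)).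
  by rewrite ler_norml; apply/andP; split; lra.
have jJ' : (1 <= j.+1 <= J)%N by case/andP: jJ => _ /ltnW ->.
have [_ x9] := IH jJ'.
have t0 := tau_gt0 j.+1.
have step : `|theta j.+1 - lambda ord0| < 9 / (2 * (N%:R * tau j.+1)).
  move: x9; rewrite offsetE normrM ger0_norm; last by rewrite mulr_ge0 ?(ltW t0).
  rewrite -ltr_pdivlMl; last by rewrite mulr_gt0//; lra.
  move=> h; apply: lt_le_trans h _; rewrite le_eqVlt; apply/orP; left; apply/eqP.
  by field; rewrite (gt_eqF t0)/= gt_eqF//; lra.
have step2 : 9 / (2 * (N%:R * tau j.+1)) <= pi / (2 * tau j.+1).
  rewrite (_ : 9 / _ = 9 / N%:R / (2 * tau j.+1)).
    rewrite ler_pM2r ?invr_gt0 ?mulr_gt0// ler_pdivrMr; last by lra.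
    by nra.
  by field; rewrite (gt_eqF t0)/= gt_eqF//; lra.
have l0 : lambda_min tau theta j.+2 <= lambda ord0 <= lambda_max tau theta j.+2.
  rewrite /lambda_min /lambda_max/=.
  by move: step; rewrite ltr_norml => /andP[s1 s2]; apply/andP; split; lra.
split=> //; apply: offset_lt => //.
have [] := run jJ; rewrite /lambda_min /lambda_max/= => /andP[t1 t2] _.
rewrite offsetE (tauS _)// normrM ger0_norm; last by rewrite !mulr_ge0 ?(ltW t0).
apply: (@le_trans _ _ (N%:R * (2 * tau j.+1) *
   (pi / (2 * tau j.+1) + 9 / (2 * (N%:R * tau j.+1))))).
  rewrite ler_wpM2l ?mulr_ge0 ?(ltW t0)//.
  move: step; rewrite ltr_norml => /andP[s1 s2].
  by rewrite ler_norml; apply/andP; split; lra.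
rewrite (_ : _ * (_ + _) = N%:R * pi + 9); first by nra.
by field; rewrite (gt_eqF t0)/= gt_eqF//; lra.
Qed.

Lemma final_level (delta : R) : (1 <= J)%N -> 0 < delta ->
  (74 / 10) ^+ 2 * (1 - p ord0) <= delta ^+ 2 ->
  (forall x, delta <= `|x| -> `|x| < 9 / 2 ->
    normc (cfourier (e' J) x - cfourier (e' J) 0) <= delta * `|x| * (1 / 50) ^+ 2) ->
  N%:R * tau J * `|theta J - lambda ord0| < delta.
Proof.
move=> J1 d0 dp G.
have JJ : (1 <= J <= J)%N by rewrite J1 leqnn.
have [l0 x9] := all_levels JJ.
have -> : N%:R * tau J * `|theta J - lambda ord0| = `|offset J|.
  by rewrite offsetE normrM (ger0_norm (mulr_ge0 _ (ltW (tau_gt0 J)))).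
rewrite ltNge; apply/negP => dx.
apply: (level_fine N1000 _ p_sum1 (y0 J) p0 (e'_small JJ) (x_max JJ l0) d0 dx x9 dp).
  by move=> m; rewrite exprn_ge0 ?normc_ge0.
exact: G.
Qed.

End levels.

(** * Choice of the parameters *)

Lemma level_indep (dsp : measure_display) (T : measurableType dsp) (R : realType)
    (P : probability T R) (N Ns J : nat) (X Y : nat -> 'I_Ns -> 'I_N -> {RV P >-> R})
    (j : nat) : (1 <= j <= J)%N ->
  mutually_independent
    (fun a : nat * 'I_Ns * 'I_N * bool => (1 <= a.1.1.1 <= J)%N)
    (fun a => if a.2 then X a.1.1.1 a.1.1.2 a.1.2 else Y a.1.1.1 a.1.1.2 a.1.2) ->
  forall B : 'I_Ns * 'I_N * bool -> set R, (forall i, measurable (B i)) ->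
  P (\big[setI/setT]_i
       ((if i.2 then X j i.1.1 i.1.2 else Y j i.1.1 i.1.2) @^-1` B i)) =
  (\prod_i P ((if i.2 then X j i.1.1 i.1.2 else Y j i.1.1 i.1.2) @^-1` B i))%E.
Proof.
move=> jJ indep B mB.
pose f (i : 'I_Ns * 'I_N * bool) : nat * 'I_Ns * 'I_N * bool := (j, i.1.1, i.1.2, i.2).
have f_inj : injective f by move=> [[a b] c] [[a' b'] c'] [-> -> ->].
have := indep (map f (index_enum _)) (fun a => B (a.1.1.2, a.1.2, a.2)).
rewrite !big_map map_inj_uniq// index_enum_uniq.
have -> : all (fun a : nat * 'I_Ns * 'I_N * bool => (0 < a.1.1.1 <= J)%N)
    (map f (index_enum _)).
  by rewrite all_map; apply/allP => i _.
move=> /(_ isT isT (fun a => mB _)) h.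
transitivity (P (\big[setI/setT]_i
   ((if (f i).2 then X (f i).1.1.1 (f i).1.1.2 (f i).1.2
     else Y (f i).1.1.1 (f i).1.1.2 (f i).1.2)
     @^-1` B ((f i).1.1.2, (f i).1.2, (f i).2)))).
  by congr (P _); apply: eq_bigr => -[[a b] c] _.
by rewrite h; apply: eq_bigr => -[[a b] c] _.
Qed.

Lemma ln2_ge_half (R : realType) : 1 / 2 <= ln 2 :> R.
Proof.
have := @expR_ge1Dx R (- ln 2); rewrite expRN lnK ?posrE//.
by lra.
Qed.

Lemma expR1_ge2 (R : realType) : 2 <= expR 1 :> R.
Proof. by have := @expR_ge1Dx R 1; lra. Qed.

Lemma expR_nat_ge (R : realType) (n : nat) : 2 ^+ n <= expR n%:R :> R.
Proof.
rewrite -[n%:R]mulr1 expRM_natl lerXn2r ?nnegrE ?expR_ge0//.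
exact: expR1_ge2.
Qed.

Lemma lnV_gt0 (R : realType) (eps : R) : 0 < eps < 1 / 2 -> 1 / 2 <= ln eps^-1.
Proof.
move=> /andP[e0 e2]; apply: le_trans (ln2_ge_half R) _.
rewrite ler_ln ?posrE ?invr_gt0// -[leLHS]invrK lef_pV2 ?posrE ?invr_gt0//.
by rewrite -div1r ltW.
Qed.

Lemma ceil_log2VE (R : realType) (eps : R) : 0 < eps < 1 / 2 ->
  ln eps^-1 / ln 2 <= (ceil_log2V eps)%:R < ln eps^-1 / ln 2 + 1.
Proof.
move=> e; have l2 := ln2_ge_half R; have le := lnV_gt0 e.
have c0 : 0 <= Num.ceil (ln eps^-1 / ln 2).
  by rewrite ltW// ceil_gt0 divr_gt0//; lra.
have := ceil_itv (ln eps^-1 / ln 2).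
rewrite /ceil_log2V natr_absz ger0_norm// => /andP[h1 ->] /=.
by move: h1; rewrite intrB ltrBlDr.
Qed.

(** The rounding and the extra level add at most 2, absorbed by 4 ln (1 / eps) because eps < 1/2. *)
Lemma qcels_J_le (R : realType) (eps : R) : 0 < eps < 1 / 2 ->
  (qcels_J eps)%:R <= 6 * ln eps^-1.
Proof.
move=> e; have /andP[_ c2] := ceil_log2VE e.
have l2 := ln2_ge_half R; have le := lnV_gt0 e.
have : ln eps^-1 / ln 2 <= 2 * ln eps^-1 by rewrite ler_pdivrMr; nra.
by rewrite /qcels_J -natr1; lra.
Qed.

Lemma qcels_tauS (R : realType) (delta eps : R) (N j : nat) :
  qcels_tau delta eps N j.+1 = 2 * qcels_tau delta eps N j.
Proof.
rewrite /qcels_tau.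
rewrite (_ : j.+1%:Z - 1 - (ceil_log2V eps)%:Z =
   1 + (j%:Z - 1 - (ceil_log2V eps)%:Z)); last by rewrite -addn1 PoszD; ring.
by rewrite expfzDr ?pnatr_eq0// expr1z -mulrA.
Qed.

Lemma qcels_tau_gt0 (R : realType) (delta eps : R) (N j : nat) :
  0 < delta -> 0 < eps -> (0 < N)%N -> 0 < qcels_tau delta eps N j.
Proof.
by move=> d0 e0 N0; rewrite mulr_gt0 ?exprz_gt0// divr_gt0// mulr_gt0 ?ltr0n.
Qed.

Lemma qcels_tauJ (R : realType) (delta eps : R) (N : nat) :
  qcels_tau delta eps N (qcels_J eps) = delta / (N%:R * eps).
Proof.
rewrite /qcels_tau /qcels_J (_ : _ - _ - _ = 0) ?expr0z ?mul1r//.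
by rewrite -addn1 PoszD; ring.
Qed.

(** The power 2 ^ ceil (log2 (1 / eps)) is at least 1 / eps, so N tau_1 <= delta. *)
Lemma qcels_tau1 (R : realType) (delta eps : R) (N : nat) :
  0 < delta <= 4 -> 0 < eps < 1 / 2 -> (0 < N)%N ->
  N%:R * qcels_tau delta eps N 1 <= 4.
Proof.
move=> /andP[d0 d4] e N0; have /andP[c1 _] := ceil_log2VE e.
case/andP: (e) => e0 e2.
have l2 : 0 < ln 2 :> R by have := ln2_ge_half R; lra.
have NR : 0 < N%:R :> R by rewrite ltr0n.
rewrite /qcels_tau subrr sub0r -exprnN.
rewrite (_ : N%:R * _ = 2 ^- ceil_log2V eps / eps * delta); last first.
  by move: (2 ^- _) => u; field; rewrite !gt_eqF.
apply: le_trans d4; rewrite ler_piMl ?(ltW d0)// ler_pdivrMr// mul1r.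
rewrite -[leRHS]invrK lef_pV2 ?posrE ?invr_gt0 ?exprn_gt0//.
rewrite -[leLHS]lnK ?posrE ?invr_gt0// -[leRHS]lnK ?posrE ?exprn_gt0//.
by rewrite ler_expR lnXn// -[leRHS]mulr_natl -ler_pdivrMr.
Qed.

Lemma T_maxE (R : realType) (delta eps : R) (N : nat) : 0 < eps -> (0 < N)%N ->
  T_max N (qcels_J eps) (qcels_tau delta eps N) = delta / eps.
Proof.
move=> e0 N0; rewrite /T_max qcels_tauJ.
have : N%:R != 0 :> R by rewrite pnatr_eq0 -lt0n.
by move=> N0'; field; rewrite gt_eqF.
Qed.

(** The time steps double, so their sum lies between the last one and twice it; N - 1 >= N / 2
    accounts for the remaining factor. *)
Lemma T_total_bounds (R : realType) (delta eps : R) (N Ns : nat) :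
  0 < delta -> 0 < eps -> (2 <= N)%N ->
  N%:R * Ns%:R * (delta / eps) / 4 <=
    T_total N Ns (qcels_J eps) (qcels_tau delta eps N) <=
    N%:R * Ns%:R * (delta / eps).
Proof.
move=> d0 e0 N2.
have N0 : (0 < N)%N by exact: ltnW.
have NR : 2 <= N%:R :> R by rewrite ler_nat.
have Ns0 : 0 <= Ns%:R :> R by [].
set tau := qcels_tau delta eps N.
have tau0 j : 0 < tau j by exact: qcels_tau_gt0.
have tauS j : tau j.+1 = 2 * tau j by exact: qcels_tauS.
have sum (J : nat) : tau J.+1 <= \sum_(1 <= j < J.+2) tau j <= 2 * tau J.+1.
  elim: J => [|J /andP[IH1 IH2]]; first by rewrite big_nat1 lexx; have := tau0 1%N; lra.
  have := tau0 J.+1; rewrite big_nat_recr//= (tauS J.+1).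
  by move: (\sum_(1 <= i < _) _) IH1 IH2 => S IH1 IH2 t0; apply/andP; split; lra.
have /andP[s1 s2] := sum (ceil_log2V eps); rewrite -/(qcels_J eps) in s1 s2.
rewrite /tau qcels_tauJ -/tau in s1 s2.
have -> : T_total N Ns (qcels_J eps) tau =
    N%:R * (N%:R - 1) * Ns%:R / 2 * \sum_(1 <= j < (qcels_J eps).+1) tau j.
  by rewrite /T_total mulr_sumr; apply: eq_bigr => j _; rewrite mulrAC.
have c0 : 0 <= N%:R * (N%:R - 1) * Ns%:R / 2 :> R.
  by rewrite !mulr_ge0//; lra.
have e1 : delta / (N%:R * eps) = N%:R^-1 * (delta / eps).
  by field; rewrite !gt_eqF//; lra.
have de : 0 < delta / eps by rewrite divr_gt0.
have Q0 : 0 <= Ns%:R * (delta / eps) by apply: mulr_ge0 => //; exact: ltW.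
rewrite e1 in s1 s2.
apply/andP; split.
  apply: le_trans (ler_wpM2l c0 s1).
  rewrite (_ : _ * _ / 2 * _ = (N%:R - 1) / 2 * (Ns%:R * (delta / eps))).
    rewrite (_ : N%:R * _ * _ / 4 = N%:R / 4 * (Ns%:R * (delta / eps))); last by ring.
    by rewrite ler_wpM2r//; lra.
  by field; rewrite !gt_eqF//; lra.
apply: le_trans (ler_wpM2l c0 s2) _.
rewrite (_ : _ * _ / 2 * _ = (N%:R - 1) * (Ns%:R * (delta / eps))).
  by rewrite -[leRHS]mulrA ler_wpM2r//; lra.
by field; rewrite !gt_eqF//; lra.
Qed.

(** Since kappa ^ 2 Ns >= 200 the exponent is at least 3 N, of which 4 ^ N <= exp (2 N) leaves exp
    (- N). The lower bound on N then gives exp N >= 16 ln (1 / eps) / eta, against at most 6 ln (1 /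
    eps) levels. *)
Lemma coarse_budget (R : realType) (kappa cmin eps eta : R) (N Ns : nat) :
  0 < kappa <= 1 -> 100 <= kappa ^+ 2 * cmin ->
  0 < eps < 1 / 2 -> 0 < eta < 1 / 2 ->
  cmin * (2 + (`|ln (ln eps^-1)| + `|ln eta^-1|)) <= N%:R ->
  cmin * (2 + (`|ln (ln eps^-1)| + `|ln eta^-1|)) <= Ns%:R ->
  (qcels_J eps)%:R * (4 ^+ N * expR (- (kappa ^+ 2 * N%:R * Ns%:R / 64))) <= eta / 2.
Proof.
move=> /andP[k0 k1] kc e h hN hNs.
have v0 := lnV_gt0 e; have hJ := qcels_J_le e; case/andP: h => h0 h2.
set v := ln eps^-1 in v0 hJ hN hNs *.
have vp : 0 < v by lra.
set a := `|ln v| in hN hNs; set b := `|_| in hN hNs.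
have a0 : 0 <= a by exact: normr_ge0.
have b0 : 0 <= b by exact: normr_ge0.
have k2 : 0 < kappa ^+ 2 by rewrite exprn_gt0.
have k21 : kappa ^+ 2 <= 1 by rewrite expr_le1// ltW.
have c100 : 100 <= cmin by nra.
have kNs : 200 <= kappa ^+ 2 * Ns%:R.
  have : kappa ^+ 2 * (cmin * 2) <= kappa ^+ 2 * Ns%:R by rewrite ler_pM2l//; nra.
  by lra.
have N4 : 4 + (a + b) <= N%:R by nra.
have e4 : 4 ^+ N <= expR (2 * N%:R) :> R.
  rewrite mulrC expRM_natl lerXn2r ?nnegrE ?expR_ge0//.
  by apply: le_trans (expR_nat_ge R 2); rewrite expr2; lra.
have e3 : expR (- (kappa ^+ 2 * N%:R * Ns%:R / 64)) <= expR (- (3 * N%:R)).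
  rewrite ler_expR lerN2 (_ : _ / 64 = kappa ^+ 2 * Ns%:R / 64 * N%:R); last by field.
  by rewrite ler_wpM2r//; lra.
have e1 : 4 ^+ N * expR (- (kappa ^+ 2 * N%:R * Ns%:R / 64)) <= expR (- N%:R).
  rewrite (_ : - N%:R = 2 * N%:R + - (3 * N%:R)); last by ring.
  by rewrite expRD ler_pM ?expR_ge0 ?exprn_ge0.
have pos : 0 <= 4 ^+ N * expR (- (kappa ^+ 2 * N%:R * Ns%:R / 64)).
  by rewrite mulr_ge0 ?expR_ge0 ?exprn_ge0.
apply: le_trans (ler_pM _ pos hJ e1) _; first exact: ler0n.
have eN : 16 * v * eta^-1 <= expR N%:R.
  apply: (@le_trans _ _ (expR (4 + (a + b)))); last by rewrite ler_expR.
  have h16 : 16 <= expR 4 :> R.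
    by apply: le_trans (expR_nat_ge R 4); rewrite (_ : 16 = 2 ^+ 4 :> R)//; ring.
  have hv : v <= expR a by rewrite -{1}[v]lnK ?posrE// ler_expR ler_norm.
  have hb : eta^-1 <= expR b.
    by rewrite -{1}[eta^-1]lnK ?posrE ?invr_gt0// ler_expR ler_norm.
  have h1 : 16 * v <= expR 4 * expR a by apply: ler_pM => //; exact: ltW.
  have v16 : 0 <= 16 * v by apply: mulr_ge0 => //; exact: ltW.
  rewrite (expRD 4) (expRD a) mulrA; apply: ler_pM => //.
  by rewrite invr_ge0 ltW.
have eNp := expR_gt0 (N%:R : R).
rewrite expRN ler_pdivrMr//.
have : eta * (16 * v * eta^-1) <= eta * expR N%:R by rewrite ler_wpM2l// ltW.
rewrite (_ : eta * (16 * v * eta^-1) = 16 * v); last by field; rewrite gt_eqF.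
by lra.
Qed.

Lemma powR_delta (R : realType) (zeta delta : R) : 0 < delta ->
  delta `^ (- (2 + zeta)) = expR (- zeta * ln delta) / delta ^+ 2.
Proof.
move=> d0; rewrite /powR gt_eqF//.
rewrite -[X in _ / X ^+ 2](lnK d0) -expRM_natl -expRN -expRD; congr expR.
by ring.
Qed.

(** delta may exceed 1, and then delta ^ (- zeta) falls below 1; it is still at least 4 ^ (-
    zeta). *)
Lemma expR_zeta_ge (R : realType) (zeta delta : R) : 0 < delta <= 4 -> 0 < zeta < 1 ->
  1 / 4 <= expR (- zeta * ln delta).
Proof.
move=> /andP[d0 d4] /andP[z0 z1].
have l4 : ln delta <= ln 4 by rewrite ler_ln ?posrE.
have l40 : 0 <= ln 4 :> R by rewrite ln_ge0//; lra.
rewrite (_ : 1 / 4 = expR (- ln 4)); last by rewrite expRN lnK ?posrE// div1r.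
rewrite ler_expR.
have [lp|ln_] := leP 0 (ln delta); nra.
Qed.

(* The union over about delta ^- 2 grid points is paid for by delta `^ (- zeta). *)
Lemma fine_budget (R : realType) (kappa cN zeta delta eta L : R) (N Ns K : nat) :
  0 < kappa -> 0 < zeta < 1 -> 0 < delta <= 4 -> 0 < eta < 1 / 2 ->
  2 + `|ln eta^-1| <= L ->
  256 * (11 + 1 / (2 * zeta)) <= kappa ^+ 2 * cN ->
  cN * (delta `^ (- (2 + zeta)) * L ^+ 2) <= N%:R * Ns%:R ->
  K%:R * delta ^+ 2 <= 21 ->
  8 * K%:R * expR (- ((kappa * delta / 2) ^+ 2 * N%:R * Ns%:R / 64)) <= eta / 2.
Proof.
move=> k0 z d4 /andP[h0 h2] hL hc hN hK.
have D4 := expR_zeta_ge d4 z; case/andP: z => z0 z1; case/andP: d4 => d0 d4.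
rewrite powR_delta// in hN; set D := expR _ in hN D4.
have Dz : - zeta * ln delta <= D.
  by rewrite /D; have := expR_ge1Dx (- zeta * ln delta); lra.
set b := `|_| in hL; have b0 : 0 <= b by exact: normr_ge0.
have d2 : 0 < delta ^+ 2 by rewrite exprn_gt0.
have k2 : 0 < kappa ^+ 2 by rewrite exprn_gt0.
set E := D * L ^+ 2.
have L2 : 2 <= L by lra.
have LL : 2 * L <= L ^+ 2 by nra.
have E1 : 1 <= E by rewrite /E; nra.
have EL : L <= 2 * E by rewrite /E; nra.
have ED : 4 * D <= E by rewrite /E; nra.
have A1 : (11 + 1 / (2 * zeta)) * E <= (kappa * delta / 2) ^+ 2 * N%:R * Ns%:R / 64.
  have h1 : kappa ^+ 2 * delta ^+ 2 * (cN * (D / delta ^+ 2 * L ^+ 2)) <=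
     kappa ^+ 2 * delta ^+ 2 * (N%:R * Ns%:R).
    by rewrite ler_wpM2l// ltW// mulr_gt0.
  have h2' : kappa ^+ 2 * delta ^+ 2 * (cN * (D / delta ^+ 2 * L ^+ 2)) =
      kappa ^+ 2 * cN * E by rewrite /E; field; rewrite gt_eqF.
  rewrite h2' in h1.
  have h3 : 256 * (11 + 1 / (2 * zeta)) * E <= kappa ^+ 2 * cN * E.
    by rewrite ler_wpM2r//; lra.
  rewrite (_ : _ / 64 = kappa ^+ 2 * delta ^+ 2 * (N%:R * Ns%:R) / 256); last by field.
  by lra.
(* On the left, exp 9 outweighs the constants, exp b the factor 1 / eta and delta ^ -2 the grid. On
   the right, 11 E covers 9 + b, and E / (2 zeta) covers - 2 ln delta because - zeta ln delta <= D
   <= E / 4. *)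
have A2 : 9 + b - 2 * ln delta <= (11 + 1 / (2 * zeta)) * E.
  have zE : 2 * D <= E / 2 by lra.
  have : - 2 * ln delta <= 1 / (2 * zeta) * E.
    rewrite (_ : 1 / (2 * zeta) * E = (E / 2) / zeta); last by field; rewrite gt_eqF.
    by rewrite ler_pdivlMr//; lra.
  by lra.
have : expR (9 + b - 2 * ln delta) <=
    expR ((kappa * delta / 2) ^+ 2 * N%:R * Ns%:R / 64) by rewrite ler_expR; lra.
rewrite expRN; move: (expR (_ / 64))
  (expR_gt0 ((kappa * delta / 2) ^+ 2 * N%:R * Ns%:R / 64)) => Q Q0.
rewrite (expRD (9 + b)) (expRD 9) => hQ; rewrite ler_pdivrMr//.
have e9 : 500 <= expR 9 :> R.
  apply: le_trans (expR_nat_ge R 9); rewrite (_ : 2 ^+ 9 = 512 :> R)//; last by ring.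
  by lra.
have eb : eta^-1 <= expR b.
  by rewrite -{1}[eta^-1]lnK ?posrE ?invr_gt0// ler_expR ler_norm.
have ed : expR (- (2 * ln delta)) = delta ^- 2.
  by rewrite expRN expRM_natl lnK.
rewrite ed in hQ.
have : eta * delta ^+ 2 * (500 * eta^-1 * delta ^- 2) <= eta * delta ^+ 2 * Q.
  rewrite ler_pM2l ?mulr_gt0//; apply: le_trans hQ.
  apply: ler_wpM2r; first by rewrite invr_ge0 ltW.
  by apply: ler_pM e9 eb; [exact: ler0n | rewrite invr_ge0 ltW].
rewrite (_ : eta * delta ^+ 2 * (500 * eta^-1 * delta ^- 2) = 500); last first.
  by field; rewrite !gt_eqF.
move=> h5; rewrite -(ler_pM2r d2).
by apply: (@le_trans _ _ (8 * 21)); [clear -hK | clear -h5]; lra.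
Qed.

Lemma size_choice_exists (R : realType) (cN cmin zeta eps eta delta : R) :
  1 <= cmin -> 64 * cmin ^+ 2 <= cN -> 0 < zeta < 1 -> 0 < delta <= 4 ->
  exists N Ns : nat, size_choice cN (4 * cN) 2 cmin 1 zeta eps eta delta N Ns.
Proof.
move=> c1 hc z d4; have c0 : 0 < cmin by exact: lt_le_trans c1.
have D4 := expR_zeta_ge d4 z; case/andP: d4 => d0 d4.
rewrite /size_choice /is_Theta /polylog !big_cons !big_nil !addr0 expr1.
rewrite powR_delta//; set D := expR _ in D4 *.
set a := `|ln (ln zeta^-1)|; set b := `|ln (ln eps^-1)|; set c := `|ln eta^-1|.
have a0 : 0 <= a by exact: normr_ge0.
have b0 : 0 <= b by exact: normr_ge0.
have c0' : 0 <= c by exact: normr_ge0.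
have d2 : 0 < delta ^+ 2 by rewrite exprn_gt0.
have D16 : 1 / 64 <= D / delta ^+ 2 by rewrite ler_pdivlMr//; nra.
set L := 2 + (a + (b + c)); set L' := 2 + (b + c).
have LL : L' <= L by rewrite /L /L'; lra.
have L'2 : 2 <= L' by rewrite /L'; lra.
have c2 : 0 < cmin ^+ 2 by rewrite exprn_gt0.
have cN0 : 0 < cN by lra.
set B := D / delta ^+ 2 * L ^+ 2.
have B0 : 0 <= cN * B.
  by rewrite mulr_ge0 ?(ltW cN0)// mulr_ge0 ?sqr_ge0//; lra.
have cB : (cmin * L') ^+ 2 <= cN * B.
  rewrite exprMn; apply: (@le_trans _ _ (64 * cmin ^+ 2 * (1 / 64 * L ^+ 2))).
    rewrite (_ : 64 * _ * _ = cmin ^+ 2 * L ^+ 2); last by field.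
    rewrite ler_pM2l// lerXn2r ?nnegrE//; lra.
  apply: ler_pM => //; first by rewrite mulr_ge0// ltW.
    by rewrite mulr_ge0 ?sqr_ge0.
  by rewrite ler_wpM2r ?sqr_ge0.
pose s := Num.sqrt (cN * B).
have s2 : s ^+ 2 = cN * B by rewrite sqr_sqrtr.
have s0 : 0 <= s by exact: sqrtr_ge0.
have cs : cmin * L' <= s.
  rewrite -(ler_pXn2r (_ : 0 < 2)%N) ?nnegrE ?s2//.
  by rewrite mulr_ge0 ?(ltW c0)//; lra.
have s1 : 1 <= s.
  apply: le_trans cs; apply: (@le_trans _ _ (1 * 1)); first by rewrite mulr1.
  by apply: ler_pM => //; lra.
have /andP[t1 t2] := truncn_itv s0.
(* Both sizes are the least integer above s; since s >= 1, their product lies between s ^ 2 and 4 s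
   ^ 2. *)
exists (Num.truncn s).+1, (Num.truncn s).+1; split => //.
  rewrite -/B -mulrA -[in X in _ && X]s2 -s2 -[(_).+1%:R]natr1.
  move: t2; rewrite -[(_).+1%:R]natr1.
  move: (_%:R) t1 => t t1 t2; apply/andP; split; nra.
by rewrite minnn; apply: le_trans cs (ltW t2).
Qed.

(** * The good event and its probability *)

Section success.
Variables (R : realType) (d : nat) (H : 'M[R[i]]_d.+1).
Variables (psi : 'I_d.+1 -> 'cV[R[i]]_d.+1) (lambda : 'I_d.+1 -> R).
Variables (phi : 'cV[R[i]]_d.+1) (eps eta delta : R) (N Ns : nat).
Variables (dsp : measure_display) (T : measurableType dsp) (P : probability T R).
Variables (X Y : nat -> 'I_Ns -> 'I_N -> {RV P >-> R}).
Variables (r : nat -> T -> R[i]) (theta : nat -> {RV P >-> R}).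
Hypothesis psi_on : forall m m', braket (psi m) (psi m') = (m == m')%:R.
Hypothesis psi_eig : forall m, H *m psi m = (lambda m)%:C *: psi m.
Hypothesis lambda0 : - pi <= lambda ord0 < pi.
Hypothesis phi1 : braket phi phi = 1.
Let p0 := normc (braket (psi ord0) phi) ^+ 2.
Let J := qcels_J eps.
Let tau := qcels_tau delta eps N.
Hypothesis p071 : 71 / 100 < p0.
Hypothesis eps2 : 0 < eps < 1 / 2.
Hypothesis delta4 : 0 < delta <= 4.
Hypothesis deltap : (74 / 10) ^+ 2 * (1 - p0) <= delta ^+ 2.
Hypothesis N1000 : (1000 <= N)%N.
Hypothesis Ns_gt0 : (0 < Ns)%N.
Hypothesis data : hadamard_data H phi J tau X Y.
Hypothesis run : forall w, qcels_run J tau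
  (fun j => sample_mean (fun k n => X j k n w) (fun k n => Y j k n w))
  (fun j => r j w) (fun j => theta j w).

Let kappa : R := (1 / 50) ^+ 2.

Lemma qcels_success (K : nat) : 9 / 2 <= K%:R * delta ^+ 2 ->
  J%:R * (4 ^+ N * expR (- (kappa ^+ 2 * N%:R * Ns%:R / 64))) <= eta / 2 ->
  8 * K%:R * expR (- ((kappa * delta / 2) ^+ 2 * N%:R * Ns%:R / 64)) <= eta / 2 ->
  ((1 - eta)%:E <= P [set w | (`|theta J w - lambda ord0| < eps)%R])%E.
Proof.
move=> Kd coarse fine.
have [XY_sign XY_mean indep] := data.
have N0 : (0 < N)%N by exact: leq_trans N1000.
have kappa0 : 0 < kappa by rewrite exprn_gt0// divr_gt0.
have kappa1 : kappa <= 1 by rewrite /kappa; lra.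
case/andP: (delta4) => d0 d4; case/andP: (eps2) => e0 _.
pose a j (n : 'I_N) := autocorr H phi (n%:R * tau j).
have JJ : (1 <= J <= J)%N by rewrite leqnn.
(* Ordinals start at 0 and levels at 1, so i stands for level i + 1. *)
have iJ (i : 'I_J) : (1 <= i.+1 <= J)%N by exact: ltn_ord.
have ev_coarse (i : 'I_J) := noise_coarse (a := a i.+1) N0 Ns_gt0
  (fun k n w => XY_sign i.+1 k n w (iJ i)) (fun k n => XY_mean i.+1 k n (iJ i))
  (level_indep (iJ i) indep).
have /choice[B hB] : forall i : 'I_J, exists B : set T, [/\ measurable B,
    (P B <= (4 ^+ N * expR (- (kappa ^+ 2 * N%:R * Ns%:R / 64)))%:E)%E &
    forall w, ~ B w ->
      N%:R^-1 * \sum_n normc (noise (X i.+1) (Y i.+1) (a i.+1) w n) <= kappa].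
  by move=> i; apply: ev_coarse; rewrite kappa0.
pose ph (n : 'I_N) := cis (n%:R * (lambda ord0 * tau J)).
have [Bf [mBf PBf hBf]] : exists Bf : set T, [/\ measurable Bf,
    (P Bf <= (8 * K%:R * expR (- ((kappa * delta / 2) ^+ 2 * N%:R * Ns%:R / 64)))%:E)%E &
    forall w, ~ Bf w -> forall (e : bool) (i : nat), (i <= K)%N ->
      let x := sgnb R e * (i%:R * delta ^+ 2) in
      normc (cfourier (fun n => noise (X J) (Y J) (a J) w n * ph n) x -
             cfourier (fun n => noise (X J) (Y J) (a J) w n * ph n) 0) <=
      kappa * delta / 2 * `|x| ].
  apply: (noise_fine (a := a J) N0 Ns_gt0
    (fun k n w => XY_sign J k n w JJ) (fun k n => XY_mean J k n JJ)
    (level_indep JJ indep)).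
  - by move=> n; exact: normc_cis.
  - by rewrite exprn_gt0.
  - have kd : 0 < kappa * delta by rewrite mulr_gt0.
    by rewrite divr_gt0//=; nra.
pose bad := Bf `|` \big[setU/set0]_(i < J) B i.
have mB i : measurable (B i) by have [] := hB i.
have mU : measurable (\big[setU/set0]_(i < J) B i).
  by apply: bigsetU_measurable => i _.
have mbad : measurable bad by exact: measurableU.
have Pbad : (P bad <= eta%:E)%E.
  apply: le_trans (measureU2 _ mBf mU) _.
  rewrite (_ : eta = eta / 2 + eta / 2); last by field.
  rewrite EFinD; apply: leeD.
    by apply: le_trans PBf _; rewrite lee_fin.
  have PB i : xpredT i -> (P (B i) <=
     (4 ^+ N * expR (- (kappa ^+ 2 * N%:R * Ns%:R / 64)))%:E)%E by have [] := hB i.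
  apply: le_trans (probability_bigsetU_le _ mB PB) _.
  by rewrite lee_fin sumr_const card_ord -[leLHS]mulr_natl.
(* From here the outcome w is fixed and the argument is deterministic. *)
have good w : ~ bad w -> `|theta J w - lambda ord0| < eps.
  move=> nbad.
  have nf : ~ Bf w by move=> h; apply: nbad; left.
  have nB i : ~ B i w.
    move=> h; apply: nbad; right; rewrite -bigcup_seq.
    by exists i => //=; exact: mem_index_enum.
  have e_small j : (1 <= j <= J)%N -> N%:R^-1 * \sum_(n < N)
      normc (sample_mean (fun k n => X j k n w) (fun k n => Y j k n w) n
        - autocorr H phi (n%:R * tau j)) <= (1 / 50) ^+ 2.
    case: j => // j /andP[_ jJ].
    by have [_ _ h] := hB (Ordinal jJ); exact: h (nB (Ordinal jJ)).
  have fin : N%:R * tau J * `|theta J w - lambda ord0| < delta.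
    apply: (final_level psi_on psi_eig lambda0 phi1 p071 N1000
      (fun j => qcels_tau_gt0 j d0 e0 N0) (fun j _ => qcels_tauS delta eps N j)
      (qcels_tau1 delta4 eps2 N0) (run w) e_small isT d0 deltap).
    apply: (@cfourier_grid _ _ (fun n => noise (X J) (Y J) (a J) w n * ph n) K).
    - rewrite (eq_bigr (fun n => normc (noise (X J) (Y J) (a J) w n))).
        exact: e_small.
      by move=> n _; rewrite normcM normc_cis mulr1.
    - exact: d0.
    - exact: ltW.
    - exact: Kd.
    - exact: hBf.
  rewrite -(ltr_pM2l (divr_gt0 d0 e0)) divfK ?gt_eqF//.
  by rewrite -(T_maxE delta e0 N0).
have mG : measurable [set w | `|theta J w - lambda ord0| < eps].
  rewrite (_ : [set w | _] = setT `&`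
      theta J @^-1` `](lambda ord0 - eps), (lambda ord0 + eps)[).
    exact: measurable_funP.
  by apply/seteqP; split => w /=; rewrite in_itv/= ltr_distl// => -[].
apply: (@le_trans _ _ (P (~` bad))).
  rewrite probability_setC// EFinB; exact: leeB.
by apply: le_measure; rewrite ?inE; [exact: measurableC | exact: mG | exact: good].
Qed.

End success.

Theorem theorem11 (R : realType) :
  exists zeta0 : R, 0 < zeta0 < 1 /\
  forall zeta : R, 0 < zeta < zeta0 ->
  exists (cdelta cN cmin : R) (k l : nat),
    [/\ 0 < cdelta, 0 < cN & 0 < cmin] /\
    (* the choices of the parameters are possible in the whole stated range *)
    (exists cdelta' cN' : R, forall p0 eps eta : R,
       71 / 100 < p0 < 1 -> 0 < eps < 1 / 2 -> 0 < eta < 1 / 2 ->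
       (exists delta : R, delta_choice cdelta cdelta' p0 delta) /\
       (forall delta : R, 0 < delta <= 4 ->
          exists N Ns : nat,
            size_choice cN cN' k cmin l zeta eps eta delta N Ns)) /\
    forall cdelta' cN' : R,
    exists ctot ctot' : R, 0 < ctot /\ 0 < ctot' /\
    forall (d : nat) (H : 'M[R[i]]_d.+1)
      (psi : 'I_d.+1 -> 'cV[R[i]]_d.+1) (lambda : 'I_d.+1 -> R)
      (phi : 'cV[R[i]]_d.+1) (eps eta delta : R) (N Ns : nat)
      (dsp : measure_display) (T : measurableType dsp) (P : probability T R)
      (X Y : nat -> 'I_Ns -> 'I_N -> {RV P >-> R})
      (r : nat -> T -> R[i]) (theta : nat -> {RV P >-> R}),
    H \is hermsymmx ->
    (forall m m', braket (psi m) (psi m') = (m == m')%:R) ->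
    (forall m, H *m psi m = (lambda m)%:C *: psi m) ->
    - pi <= lambda ord0 < pi ->
    braket phi phi = 1 ->
    let p0 := normc (braket (psi ord0) phi) ^+ 2 in
    let J := qcels_J eps in
    let tau := qcels_tau delta eps N in
    71 / 100 < p0 ->
    0 < eta < 1 / 2 ->
    0 < eps < 1 / 2 ->
    delta_choice cdelta cdelta' p0 delta ->
    size_choice cN cN' k cmin l zeta eps eta delta N Ns ->
    hadamard_data H phi J tau X Y ->
    (forall w, qcels_run J tau
       (fun j => sample_mean (fun k n => X j k n w) (fun k n => Y j k n w))
       (fun j => r j w) (fun j => theta j w)) ->
    [/\ ((1 - eta)%:E <=
           P [set w | (`|theta J w - lambda ord0| < eps)%R])%E,
        T_max N J tau = delta / eps
      & is_Theta ctot ctot' (T_total N Ns J tau)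
          (polylog k [:: ln zeta^-1; ln eps^-1; eta^-1] /
           (delta `^ (1 + zeta) * eps))].
Proof.
exists (1 / 2); split; first by apply/andP; split; lra.
move=> zeta /andP[z0 z2].
have z1 : 0 < zeta < 1 by rewrite z0/=; lra.
pose kappa : R := (1 / 50) ^+ 2.
pose cmin : R := 100 / kappa ^+ 2.
(* The first summand serves [fine_budget], the second [size_choice_exists]. *)
pose cN : R := 256 * (11 + 1 / (2 * zeta)) / kappa ^+ 2 + 64 * cmin ^+ 2.
have k0 : 0 < kappa by rewrite /kappa; lra.
have k1 : kappa <= 1 by rewrite /kappa; lra.
have kk0 : 0 < kappa ^+ 2 by rewrite exprn_gt0.
have kk1 : kappa ^+ 2 <= 1 / 10 by rewrite /kappa; lra.
have kc : kappa ^+ 2 * cmin = 100 by rewrite mulrC divfK// gt_eqF.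
have c1 : 1000 <= cmin by rewrite ler_pdivlMr//; nra.
have iz0 : 0 < 1 / (2 * zeta) by rewrite divr_gt0// mulr_gt0.
have q0 : 0 < 256 * (11 + 1 / (2 * zeta)) / kappa ^+ 2.
  by apply: divr_gt0; last exact: kk0; apply: mulr_gt0; lra.
have cm2 : 0 < cmin ^+ 2 by rewrite exprn_gt0//; lra.
have cN0 : 0 < cN by rewrite /cN; lra.
have kcN : 256 * (11 + 1 / (2 * zeta)) <= kappa ^+ 2 * cN.
  have km : 0 <= kappa ^+ 2 * (64 * cmin ^+ 2).
    by apply: mulr_ge0; [exact: ltW | lra].
  by rewrite /cN [leRHS]mulrDr [kappa ^+ 2 * (_ / _)]mulrC divfK ?gt_eqF// lerDl.
exists (74 / 10), cN, cmin, 2%N, 1%N; split.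
  by split => //; lra.
split.
  exists (74 / 10), (4 * cN) => p0 eps eta /andP[p71 p1] e h; split.
    (* At most 4, since 7.4 ^ 2 * 0.29 < 16. *)
    exists (74 / 10 * Num.sqrt (1 - p0)).
    rewrite /delta_choice /is_Theta !lexx; split => //.
    have s2 : Num.sqrt (1 - p0) ^+ 2 = 1 - p0.
      by rewrite sqr_sqrtr// subr_ge0 ltW.
    have s0 : 0 < Num.sqrt (1 - p0) by rewrite sqrtr_gt0 subr_gt0.
    by clear -s0 s2 p71; apply/andP; split; nra.
  move=> delta d4; apply: size_choice_exists => //.
    by clear -c1; lra.
  by rewrite lerDr ltW.
move=> cdelta' cN'.
(* [cN'] is arbitrary, possibly not positive, whereas the constants for the total time must be
   positive. *)
exists (cN / 4), (`|cN'| + 1); split; first by rewrite divr_gt0.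
split; first by have := normr_ge0 cN'; lra.
move=> d H psi lambda phi eps eta delta N Ns dsp T P X Y r theta.
move=> _ psi_on psi_eig lambda0 phi1 p0 J tau p71 h e [d4 /andP[dp _]].
rewrite /size_choice /is_Theta /polylog !big_cons !big_nil !addr0 expr1.
set L := 2 + (`|_| + (_ + _)); set L' := 2 + (`|_| + _).
move=> -[N0 Ns0 /andP[hN1 hN2] hmin] data run.
have L'2 : 2 <= L'.
  by rewrite lerDl addr_ge0.
have LL : 2 + `|ln eta^-1| <= L.
  by rewrite lerD2l addrA lerDr addr_ge0.
have hN : cmin * L' <= N%:R by apply: le_trans hmin _; rewrite ler_nat geq_minl.
have hNs : cmin * L' <= Ns%:R by apply: le_trans hmin _; rewrite ler_nat geq_minr.
have N1000 : (1000 <= N)%N by rewrite -(ler_nat R); clear -c1 L'2 hN; nra.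
case/andP: (d4) => d0 dle4; case/andP: (e) => e0 e2.
have d2 : 0 < delta ^+ 2 by rewrite exprn_gt0.
split.
(* Just enough steps of length delta ^ 2 to reach 9/2. One step is at most 16, whence the bound 21
   on their total length. *)
- pose K := (Num.truncn (9 / 2 / delta ^+ 2)).+1.
  have /andP[t1 t2] : (Num.truncn (9 / 2 / delta ^+ 2))%:R <= 9 / 2 / delta ^+ 2 <
      K%:R by apply: truncn_itv; rewrite !divr_ge0// ltW.
  have K1 : 9 / 2 <= K%:R * delta ^+ 2 by rewrite -ler_pdivrMr// ltW.
  have K2 : K%:R * delta ^+ 2 <= 21.
    move: t1; rewrite ler_pdivlMr// => t1.
    by rewrite /K -natr1 mulrDl mul1r; clear -t1 d0 dle4; nra.
  have dp2 : (74 / 10) ^+ 2 * (1 - p0) <= delta ^+ 2.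
    have s0 := sqrtr_ge0 (1 - p0).
    have [h1|h1] := leP 0 (1 - p0); last by clear -h1 d2; nra.
    by rewrite -(sqr_sqrtr h1) -exprMn lerXn2r ?nnegrE ?mulr_ge0 ?(ltW d0).
  apply: (qcels_success psi_on psi_eig lambda0 phi1 p71 e d4 dp2 N1000 Ns0 data run K1).
    by apply: (coarse_budget (cmin := cmin)); rewrite ?k0 ?kc.
  exact: (fine_budget k0 z1 d4 h LL kcN hN1 K2).
- exact: T_maxE.
- have N2 : (2 <= N)%N by exact: leq_trans N1000.
  have /andP[T1 T2] := T_total_bounds Ns d0 e0 N2.
  rewrite -/tau -/J in T1 T2.
  have de : 0 < delta / eps by rewrite divr_gt0.
  have eB : delta `^ (- (2 + zeta)) * L ^+ 2 * (delta / eps) =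
      L ^+ 2 / (delta `^ (1 + zeta) * eps).
    have -> : delta `^ (- (2 + zeta)) = (delta `^ (1 + zeta))^-1 / delta.
      rewrite -powRN -[X in _ / X]powRr1 ?(ltW d0)// -powRN -powRD; last first.
        by apply/implyP => _; rewrite gt_eqF.
      by congr (_ `^ _); ring.
    by field; rewrite !gt_eqF// powR_gt0.
  have B0 : 0 <= delta `^ (- (2 + zeta)) * L ^+ 2.
    by rewrite mulr_ge0 ?powR_ge0 ?sqr_ge0.
  rewrite -eB; set B := _ * L ^+ 2 in hN1 hN2 B0 *; apply/andP; split.
    have h1 : cN * B * (delta / eps) <= N%:R * Ns%:R * (delta / eps).
      by rewrite ler_wpM2r// ltW.
    apply: le_trans T1; rewrite mulrA (_ : cN / 4 * B = cN * B / 4); last by ring.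
    by rewrite mulrAC ler_wpM2r.
  apply: le_trans T2 _; rewrite [leRHS]mulrA ler_pM2r//; apply: le_trans hN2 _.
  by rewrite ler_wpM2r//; apply: le_trans (ler_norm _) _; rewrite lerDl.
Qed.
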